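(* Let $X=(X,d)$ be a compact ultrametric Polish space. Then both the $\mathsf L(d)$-hierarchy and the $\mathsf{Lip}(d)$-hierarchy on the Borel subsets of $X$ are very good.
   Context: Work in ZF + DC($\mathbb{R}$). An ultrametric Polish space is a separable metric space $(X,d)$ with $d$ a complete ultrametric. $\mathsf L(d)$: maps $f\colon X\to X$ with $d(f(x),f(y))\le d(x,y)$; $\mathsf{Lip}(d)$: maps Lipschitz with some constant. For $\mathcal F$ either class, $A\le_{\mathcal F}B$ iff $A=f^{-1}(B)$ for some $f\in\mathcal F$; $A<_{\mathcal F}B$ iff $A\le_{\mathcal F}B$ and $B\not\le_{\mathcal F}A$. Very good on Borel sets: (i) for all Borel $A,B$, $A\le_{\mathcal F}B$ or $X\setminus B\le_{\mathcal F}A$, (ii) no sequence of Borel sets with $A_{n+1}<_{\mathcal F}A_n$ for all $n$. *)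

(* Defs.v *)
From HB Require Import structures.
From mathcomp Require Import all_boot all_order all_algebra.
From mathcomp Require Import all_classical all_reals all_analysis.

Set Implicit Arguments.
Unset Strict Implicit.
Unset Printing Implicit Defensive.

Import Order.TTheory GRing.Theory Num.Theory.
Import numFieldNormedType.Exports.

Local Open Scope classical_set_scope.
Local Open Scope ring_scope.

Definition ultrametric (R : realType) (X : metricType R) : Prop :=
  forall x y z : X, mdist x z <= Num.max (mdist x y) (mdist y z).

Definition separable (X : topologicalType) : Prop :=
  exists2 D : set X, countable D & dense D.

(* The library's [completeType] is pointed; this is stated without a base
   point, so that the empty space is not excluded. *)
Definition complete_metric (R : realType) (X : metricType R) : Prop :=
  forall u : nat -> X, cauchy (u @ \oo) -> exists l : X, u @ \oo --> l.

Definition ultrametric_Polish (R : realType) (X : metricType R) : Prop :=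
  [/\ ultrametric X, separable X & complete_metric X].

Definition Borel (X : topologicalType) : set (set X) := <<s @open X >>.

Definition nonexpansive_maps (R : realType) (X : metricType R) :
    set (X -> X) :=
  [set f | forall x y, mdist (f x) (f y) <= mdist x y].

Definition Lipschitz_maps (R : realType) (X : metricType R) :
    set (X -> X) :=
  [set f | exists2 L : R, 0 <= L &
             forall x y, mdist (f x) (f y) <= L * mdist x y].

Section reducibility.
Variables (X : Type) (F : set (X -> X)).

Definition reducible (A B : set X) : Prop := exists2 f, F f & A = f @^-1` B.

Definition strictly_reducible (A B : set X) : Prop :=
  reducible A B /\ ~ reducible B A.

End reducibility.

Definition very_good_on_Borel (X : topologicalType) (F : set (X -> X)) : Prop :=
  (forall A B : set X, Borel A -> Borel B ->
     reducible F A B \/ reducible F (~` B) A) /\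
  ~ (exists A : nat -> set X,
       (forall n, Borel (A n)) /\
       (forall n, strictly_reducible F (A n.+1) (A n))).

(* Main.v *)
Require Import Defs.
From HB Require Import structures.
From mathcomp Require Import all_boot all_order all_algebra.
From mathcomp Require Import all_classical all_reals all_analysis.
From mathcomp Require Import zify.

(** Nonexpansive self-maps of a compact ultrametric space are the strategies of
    a game: the positive distances form a sequence [r 0 > r 1 > ...], and two
    players alternately refine points [x] and [y], the [i]-th moves being
    constrained up to distance [r i].  The second player tries to achieve
    [x \in A <-> y \in B]; a winning strategy is a nonexpansive reduction of [A]
    to [B], while a winning strategy of the first player is a reduction of the
    complement of [B] to [A] that moreover gains one level of precision.  So
    semilinear ordering follows from Borel determinacy.

    Borel determinacy is proved by Martin's method of unravelling.  Positions may
    be dead ends, and the player who is stuck loses.  This allows a closed set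
    with tree [C] to be unravelled by the following auxiliary moves: at stage [k]
    the mover announces a set [P] of positions, and the opponent answers either
    with a challenge [u] outside [C] and [P], through which the play must then
    pass, or by accepting.  After acceptance the first position [v] outside [C]
    (with the mover to play) is a loss for the mover if [v \in P] and a loss for
    the opponent otherwise.

    Given a descending chain, the first player wins all the games comparing [A n]
    with [A n.+1] and with its complement.  Composing these contractions along a
    sequence of bits (Martin and Monk) yields a subset of the Cantor space whose
    membership changes with every single bit, contradicting the Baire property. *)

Set Implicit Arguments.
Unset Strict Implicit.
Unset Printing Implicit Defensive.

Import Order.TTheory GRing.Theory Num.Theory.
Import numFieldNormedType.Exports.

Local Open Scope classical_set_scope.
Local Open Scope nat_scope.

(** * Games on trees *)

Section pickd.
Variables (T : Type) (t0 : T).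

Definition pickd (P : T -> Prop) : T :=
  if pselect (exists t, P t) is left e then projT1 (cid e) else t0.

Lemma pickdP (P : T -> Prop) : (exists t, P t) -> P (pickd P).
Proof. by move=> e; rewrite /pickd; case: pselect => // e'; case: (cid e'). Qed.

(** The pick depends on the predicate alone. This makes the strategy maps local: strategies that
    agree up to a level yield the same picks there. *)
Lemma eq_pickd (P Q : T -> Prop) : (forall t, P t <-> Q t) -> pickd P = pickd Q.
Proof. by move=> PQ; congr pickd; apply/funext => t; apply/propext. Qed.

End pickd.

Section seq_lemmas.
Variable M : Type.
Implicit Types (s t : seq M) (x : nat -> M).

Lemma take_mkseq x n m : n <= m -> take n (mkseq x m) = mkseq x n.
Proof. by move=> nm; rewrite /mkseq -map_take take_iota (minn_idPl nm). Qed.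

Lemma take_rcons_le n s m : n <= size s -> take n (rcons s m) = take n s.
Proof. by move=> ns; rewrite -cats1 takel_cat. Qed.

Lemma take_rcons_size s m : take (size s) (rcons s m) = s.
Proof. by rewrite take_rcons_le // take_size. Qed.

Lemma rcons_closed_take (S : set (seq M)) :
  (forall s m, S (rcons s m) -> S s) -> forall j s, S s -> S (take j s).
Proof.
move=> SP j s; elim/last_ind: s => [|s m IH] // Ss.
have [js|sj] := leqP j (size s).
  by rewrite take_rcons_le //; apply: IH; apply: SP Ss.
by rewrite take_oversize // size_rcons.
Qed.

Lemma take_succ j s : j < size s -> exists m, take j.+1 s = rcons (take j s) m.
Proof.
elim: s j => // a s IH [|j] /=; first by rewrite take0; exists a.
by rewrite ltnS => /IH [m ->]; exists m.
Qed.

End seq_lemmas.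

Section games.
Variable M : Type.
Implicit Types (T S : set (seq M)) (s t : seq M) (x : nat -> M) (b : bool).

Definition is_tree T := T [::] /\ forall s m, T (rcons s m) -> T s.

Definition branch S x := forall n, S (mkseq x n).

Definition agree n S S' := forall s, size s <= n -> (S s <-> S' s).

(* Player [b] moves at the positions [s] with [odd (size s) = b].  Strategies are
   nondeterministic, given by their set of positions, and [n] bounds the
   positions at which they have to prescribe moves. *)
Record strategy T b n S : Prop := Strategy {
  strategy_nil : S [::];
  strategy_sub : S `<=` T;
  strategy_rcons : forall s m, S (rcons s m) -> S s;
  strategy_own : forall s, S s -> size s < n -> odd (size s) = b ->
    exists m, S (rcons s m);
  strategy_opp : forall s m, S s -> size s < n -> odd (size s) != b ->
    T (rcons s m) -> S (rcons s m) }.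

Lemma strategy_take T b n S j s : strategy T b n S -> S s -> S (take j s).
Proof. by move=> SS; apply: rcons_closed_take; apply: strategy_rcons SS. Qed.

Lemma strategy_le T b n m S : m <= n -> strategy T b n S -> strategy T b m S.
Proof.
move=> mn [S0 ST SP SO SC]; split=> // [s Ss sm sb|s a Ss sm sb Tsa].
  by apply: SO => //; apply: leq_trans mn.
by apply: SC => //; apply: leq_trans mn.
Qed.

(** Backward induction needs a notion relative to a position [s0]. Here [S] may contain positions
    unrelated to [s0] and need not be closed under prefixes. *)
Definition winning T b (W : set (nat -> M)) s0 S :=
  [/\ S s0,
      forall s, S s -> odd (size s) = b -> exists2 m, T (rcons s m) & S (rcons s m),
      forall s m, S s -> odd (size s) != b -> T (rcons s m) -> S (rcons s m) &
      forall x, branch T x -> mkseq x (size s0) = s0 ->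
        (forall n, size s0 <= n -> S (mkseq x n)) -> W x].

Definition wins T b W s0 := exists S, winning T b W s0 S.

Lemma wins_own T b W s m : odd (size s) = b -> T (rcons s m) ->
  wins T b W (rcons s m) -> wins T b W s.
Proof.
move=> sb Tsm [S [Ss SO SC SW]].
(* Restricting [S] to the extensions of [rcons s m] keeps its unrelated positions out, so that every
   play passes through [rcons s m]. *)
exists [set t | t = s \/ S t /\ take (size s).+1 t = rcons s m]; split.
- by left.
- move=> t [-> _|[St tE] tb].
    by exists m => //=; right; split=> //; rewrite take_oversize ?size_rcons.
  have [a Ta Sa] := SO t St tb; exists a => //=; right; split=> //.
  rewrite take_rcons_le // -(size_rcons s m) -tE size_take_min geq_minr //.
- move=> t a [->|[St tE]] tb Ta; first by rewrite sb eqxx in tb.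
  right; split; first exact: SC.
  by rewrite take_rcons_le // -(size_rcons s m) -tE size_take_min geq_minr.
- move=> x Tx xs Sx; apply: SW => //.
    have [e|[_ <-]] := Sx (size s).+1 (leqnSn _).
      by have := congr1 size e; rewrite size_mkseq => /esym/n_Sn.
    by rewrite size_take_min !size_mkseq minnn take_mkseq.
  move=> n; rewrite size_rcons => sn; have [e|[]//] := Sx n (ltnW sn).
  by move: sn; rewrite -e size_mkseq ltnn.
Qed.

Lemma wins_opp T b W s : odd (size s) != b ->
  (forall m, T (rcons s m) -> wins T b W (rcons s m)) -> wins T b W s.
Proof.
move=> sb Wm.
have [m|Sm SmP] := @choice _ _ (fun m S => T (rcons s m) ->
    winning T b W (rcons s m) S).
  have [/Wm [S SP]|nT] := pselect (T (rcons s m)); first by exists S.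
  by exists set0.
exists [set t | t = s \/ exists m,
  [/\ T (rcons s m), Sm m t & take (size s).+1 t = rcons s m]]; split.
- by left.
- move=> t [->|[m [Tm St tE]]] tb; first by rewrite tb eqxx in sb.
  have [_ SO _ _] := SmP m Tm; have [a Ta Sa] := SO t St tb.
  exists a => //; right; exists m; split=> //.
  by rewrite take_rcons_le // -(size_rcons s m) -tE size_take_min geq_minr.
- move=> t a [-> _ Ta|[m [Tm St tE]] tb Ta]; right.
    exists a; split=> //; last by rewrite take_oversize ?size_rcons.
    by have [] := SmP a Ta.
  exists m; split=> //; first by have [_ _ SC _] := SmP m Tm; apply: SC.
  by rewrite take_rcons_le // -(size_rcons s m) -tE size_take_min geq_minr.
- move=> x Tx xs Sx.
  have xm : rcons s (x (size s)) = mkseq x (size s).+1 by rewrite mkseqS xs.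
  have Tm : T (rcons s (x (size s))) by rewrite xm; apply: Tx.
  have [_ _ _] := SmP _ Tm; apply=> //; first by rewrite size_rcons xm.
  move=> n; rewrite size_rcons => sn; have [e|[m [_ Smn]]] := Sx n (ltnW sn).
    by move: sn; rewrite -e size_mkseq ltnn.
  by rewrite take_mkseq // -xm => /rcons_inj [->].
Qed.

(** Player [b] can drive the opponent into a dead end in finitely many moves, without a uniform
    bound. The base case is hidden in [forces_stuck_opp]: a position where the opponent has no
    move. *)
Inductive forces_stuck T b : seq M -> Prop :=
| forces_stuck_own s m : odd (size s) = b -> T (rcons s m) ->
    forces_stuck T b (rcons s m) -> forces_stuck T b s
| forces_stuck_opp s : odd (size s) != b ->
    (forall m, T (rcons s m) -> forces_stuck T b (rcons s m)) ->
    forces_stuck T b s.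

Lemma forces_stuck_wins T b W s : forces_stuck T b s -> wins T b W s.
Proof.
elim=> {}s; first by move=> m sb Tm _; apply: wins_own.
by move=> sb _ IH; apply: wins_opp.
Qed.

(** Player [b] keeps to the positions where the opponent cannot force a dead end. This never gets
    stuck, and an infinite play is won by hypothesis. *)
Lemma not_forces_stuck_wins T b W s : ~ forces_stuck T (~~ b) s ->
  (forall x, branch T x -> mkseq x (size s) = s -> W x) -> wins T b W s.
Proof.
move=> nF sW; exists [set t | ~ forces_stuck T (~~ b) t]; split=> //.
- move=> t nt tb; apply: contrapT => nm; apply: nt; apply: forces_stuck_opp.
    by rewrite tb; case: (b).
  by move=> m Tm; apply: contrapT => nm'; apply: nm; exists m.
- move=> t m nt tb Tm; apply: contra_not nt; apply: forces_stuck_own => //.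
  by move: tb; case: (odd _); case: (b).
- by move=> x Tx xs _; apply: sW.
Qed.

(** Clopen sets decided at one level [n]. The purpose of unravelling is to bring Borel payoffs into
    this form. *)
Definition level_determined T (A : set (nat -> M)) := exists n (D : set (seq M)),
  forall x, branch T x -> (A x <-> D (mkseq x n)).

(** Backward induction from level [n]. There the payoff is settled, and it only remains to see
    whether the losing side can force a dead end. *)
Lemma level_determined_wins T A : level_determined T A ->
  wins T true A [::] \/ wins T false (~` A) [::].
Proof.
move=> [n [D AD]].
suff H d s : n - size s <= d -> wins T true A s \/ wins T false (~` A) s.
  by apply: (H n); rewrite leq_subr.
elim: d s => [|d IH] s nd.
  have ns : n <= size s by rewrite -subn_eq0 -leqn0.
  have DE x : mkseq x (size s) = s -> mkseq x n = take n s.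
    by move=> <-; rewrite take_mkseq // size_mkseq.
  have [Ds|nDs] := pselect (D (take n s)).
    have [F|nF] := pselect (forces_stuck T false s).
      by right; apply: forces_stuck_wins.
    left; apply: not_forces_stuck_wins => // x Tx xs.
    by apply/(AD _ Tx); rewrite DE.
  have [F|nF] := pselect (forces_stuck T true s).
    by left; apply: forces_stuck_wins.
  right; apply: not_forces_stuck_wins => // x Tx xs.
  by move=> /(AD _ Tx); rewrite DE.
have IH' m : wins T true A (rcons s m) \/ wins T false (~` A) (rcons s m).
  by apply: IH; rewrite size_rcons subnS; lia.
case: (boolP (odd (size s))) => sb.
  have [[m [Tm Wm]]|nW] :=
      pselect (exists m, T (rcons s m) /\ wins T true A (rcons s m)).
    by left; apply: wins_own Tm Wm.
  right; apply: wins_opp; first by rewrite sb.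
  by move=> m Tm; case: (IH' m) => // Wm; case: nW; exists m.
have [[m [Tm Wm]]|nW] :=
    pselect (exists m, T (rcons s m) /\ wins T false (~` A) (rcons s m)).
  by right; apply: wins_own Tm Wm; apply: negbTE.
left; apply: wins_opp; first by rewrite (negbTE sb).
by move=> m Tm; case: (IH' m) => // Wm; case: nW; exists m.
Qed.

(** Keeping the positions all of whose prefixes lie in [S] and [T] restores closure under
    prefixes. *)
Lemma wins_strategy T b W : is_tree T -> wins T b W [::] -> exists S,
  (forall n, strategy T b n S) /\ forall x, branch S x -> W x.
Proof.
move=> [T0 TP] [S [S0 SO SC SW]].
exists [set s | forall j, S (take j s) /\ T (take j s)]; split; last first.
  move=> x Sx; have H n : S (mkseq x n) /\ T (mkseq x n).
    by have := Sx n n; rewrite take_mkseq.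
  by apply: SW => // n; case: (H n).
have Srcons s m : (forall j, S (take j s) /\ T (take j s)) ->
    S (rcons s m) -> T (rcons s m) ->
    forall j, S (take j (rcons s m)) /\ T (take j (rcons s m)).
  move=> Ss Sm Tm j; have [js|sj] := leqP j (size s); first by rewrite take_rcons_le.
  by rewrite take_oversize ?size_rcons.
move=> n; split=> //.
- by move=> s /(_ (size s)); rewrite take_size => -[].
- move=> s m Sm j; have [js|sj] := leqP j (size s).
    by have := Sm j; rewrite take_rcons_le.
  by rewrite take_oversize 1?ltnW //; have := Sm (size s); rewrite take_rcons_size.
- move=> s Ss _ sb; have [Ss' Ts'] := Ss (size s).
  rewrite take_size in Ss' Ts'; have [m Tm Sm] := SO s Ss' sb.
  by exists m; apply: Srcons.
- move=> s m Ss _ sb Tm; have [Ss' Ts'] := Ss (size s).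
  by rewrite take_size in Ss' Ts'; apply: Srcons => //; apply: SC.
Qed.

End games.

(** * Coverings and the unravelling of closed sets *)

(* [lifts_agree] makes the strategy maps of an infinite tower of coverings
   stabilise at every level; this is what inverse limits rely on. *)
Record lifts_strategies (M M' : Type) k (T : set (seq M)) (T' : set (seq M'))
    (q : M' -> M) b (phi : set (seq M') -> set (seq M)) : Prop := {
  lifts_agree : forall n S S', agree n S S' -> agree n (phi S) (phi S');
  lifts_strategy : forall n S, strategy T' b n S -> strategy T b n (phi S);
  lifts_low : forall S, strategy T' b 0 S -> forall s, size s <= k ->
    (phi S s <-> exists2 s', S s' & map q s' = s);
  lifts_branch : forall S, (forall n, strategy T' b n S) ->
    forall x, branch (phi S) x -> exists2 x', branch S x' & q \o x' = x }.

(** Strategies are carried from [T'] down to [T], and plays of the image back up to [T']. Up to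
    length [k] the two trees are identified, so that a tower with growing [k] has a limit. *)
Record covering (M M' : Type) k (T : set (seq M)) (T' : set (seq M'))
    (q : M' -> M) : Prop := {
  covering_tree : is_tree T';
  covering_map : forall s, T' s -> T (map q s);
  covering_inj : forall s s', T' s -> T' s' -> size s <= k ->
    map q s = map q s' -> s = s';
  covering_surj : forall s, T s -> size s <= k ->
    exists2 s', T' s' & map q s' = s;
  covering_lifts : forall b, exists phi, lifts_strategies k T T' q b phi }.

Lemma covering_id M k (T : set (seq M)) : is_tree T -> covering k T T id.
Proof.
move=> Tt; split=> //; first by move=> s; rewrite map_id.
- by move=> s s' _ _ _; rewrite !map_id.
- by move=> s Ts _; exists s; rewrite ?map_id.
- move=> b; exists id; split=> //.
  + move=> S SS s _; split=> [Ss|[s' Ss' <-]]; last by rewrite map_id.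
    by exists s; rewrite ?map_id.
  + by move=> S SS x Sx; exists x.
Qed.

Lemma covering_comp M M' M'' k (T : set (seq M)) (T' : set (seq M'))
    (T'' : set (seq M'')) q q' : covering k T T' q -> covering k T' T'' q' ->
  covering k T T'' (q \o q').
Proof.
move=> [Tt Tm Ti Ts Tl] [Tt' Tm' Ti' Ts' Tl']; split=> //.
- by move=> s /Tm' /Tm; rewrite -map_comp.
- move=> s s' Ts0 Ts1 sk; rewrite (map_comp q q' s) (map_comp q q' s') => /Ti e.
  by apply: Ti' => //; apply: e; rewrite ?size_map //; apply: Tm'.
- move=> s Ts0 sk; have [s' Ts1 s'E] := Ts s Ts0 sk.
  have [|s'' Ts2 s''E] := Ts' s' Ts1; first by rewrite -(size_map q) s'E.
  by exists s'' => //; rewrite (map_comp q q') s''E.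
- move=> b; have [phi [pa ps pl pb]] := Tl b.
  have [phi' [pa' ps' pl' pb']] := Tl' b; exists (phi \o phi'); split=> //.
  + by move=> n S S' SS'; apply/pa/pa'.
  + by move=> n S SS; apply/ps/ps'.
  + move=> S SS s sk; split=> [/(pl _ (ps' _ _ SS) _ sk)[s' + s'E]|[s'' Ss'' s''E]].
      have s'k : size s' <= k by rewrite -(size_map q) s'E.
      move=> /(pl' _ SS _ s'k)[s'' Ss'' s''E].
      by exists s'' => //; rewrite (map_comp q q') s''E.
    apply/(pl _ (ps' _ _ SS) _ sk); exists (map q' s''); last by rewrite -map_comp.
    apply/(pl' _ SS); last by exists s''.
    by rewrite size_map -(size_map (q \o q')) s''E.
  + move=> S SS x /(pb _ (fun n => ps' _ _ (SS n)))[x' + <-].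
    by move=> /(pb' _ SS)[x'' Sx'' <-]; exists x''.
Qed.

(** * The unravelling of the closed set [branch C] *)

Section closed_unravelling.
Variables (M : Type) (k : nat) (T C : set (seq M)).
Hypothesis T_tree : is_tree T.
Hypothesis C_rcons : forall s m, C (rcons s m) -> C s.

Let T_take j s : T s -> T (take j s).
Proof. by case: T_tree => _ TP; apply: rcons_closed_take. Qed.

Let C_take j s : C s -> C (take j s).
Proof. exact: rcons_closed_take. Qed.

Local Notation move := (M * (set (seq M) * option (seq M)))%type.

Definition label (P : set (seq M)) (c : option (seq M)) i :=
  (if i == k then P else set0, if i == k.+1 then c else None).

(* The promise [P] is played at move [k], the answer [c] at move [k.+1]: a
   challenge [Some u], or [None] for acceptance. *)
Definition annotate P c (s : seq M) : seq move :=
  [seq (im.2, label P c im.1) | im <- zip (iota 0 (size s)) s].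

Lemma annotate_rcons P c s m :
  annotate P c (rcons s m) = rcons (annotate P c s) (m, label P c (size s)).
Proof.
by rewrite /annotate size_rcons -addn1 iotaD cats1 zip_rcons ?size_iota // map_rcons.
Qed.

Lemma size_annotate P c s : size (annotate P c s) = size s.
Proof. by rewrite size_map size_zip size_iota minnn. Qed.

Lemma map_fst_annotate P c s : map fst (annotate P c s) = s.
Proof.
by elim/last_ind: s => // s m IH; rewrite annotate_rcons map_rcons IH.
Qed.

Lemma take_annotate P c j s : take j (annotate P c s) = annotate P c (take j s).
Proof.
elim/last_ind: s => // s m IH; have [js|sj] := leqP j (size s).
  by rewrite annotate_rcons !take_rcons_le // size_annotate.
by rewrite !take_oversize // ?size_annotate size_rcons.
Qed.

Lemma annotate_mkseq P c x n :
  annotate P c (mkseq x n) = mkseq (fun i => (x i, label P c i)) n.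
Proof. by elim: n => // n IH; rewrite !mkseqS annotate_rcons IH size_mkseq. Qed.

Lemma eq_annotate P P' c c' s : (k < size s -> P = P') ->
  (k.+1 < size s -> c = c') -> annotate P c s = annotate P' c' s.
Proof.
elim/last_ind: s => // s m IH; rewrite size_rcons => PP cc.
rewrite !annotate_rcons IH => [|ks|ks]; last 2 first.
- by apply: PP; apply: ltnW.
- by apply: cc; apply: ltnW.
rewrite /label; congr (rcons _ (_, (_, _))); first by case: eqP => // e; apply: PP; lia.
by case: eqP => // e; apply: cc; lia.
Qed.

Lemma annotate_inj P P' c c' s s' : annotate P c s = annotate P' c' s' ->
  [/\ s = s', k < size s -> P = P' & k.+1 < size s -> c = c'].
Proof.
move=> e; have := congr1 (map fst) e; rewrite !map_fst_annotate => es; subst s'.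
split=> //; elim/last_ind: s e => // s m IH;
  rewrite !annotate_rcons size_rcons => /rcons_inj [/IH{}IH PP cc];
  rewrite ltnS leq_eqVlt => /orP[/eqP e|//].
- by move: PP; rewrite -e eqxx.
- by move: cc; rewrite -e eqxx.
Qed.

(* After acceptance the mover has no move at a position [v] of [P], and the
   opponent none after a position [v] outside [C], where the mover is to play
   at [v]. *)
Definition legal P c s := T s /\
  match c with
  | Some u => [/\ ~ C u, odd (size u) = odd k, k.+1 < size u, ~ P u &
                  take (size u) s = take (size s) u]
  | None => forall j, k.+1 < j -> odd j = odd k -> j < size s ->
      ~ P (take j s) /\ (j.+1 < size s -> C (take j s))
  end.

Definition unravelled : set (seq move) :=
  [set s' | exists P c s, s' = annotate P c s /\ legal P c s].

Local Notation T' := unravelled.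

Lemma legal_take P c j s : legal P c s -> legal P c (take j s).
Proof.
move=> [Ts Ps]; split; first exact: T_take.
have [js|sj] := leqP (size s) j; first by rewrite take_oversize.
case: c Ps => [u [Cu ou ku Pu us]|Ps].
  split=> //; rewrite size_takel ?(ltnW sj) // takeC us take_takel //.
  exact: ltnW.
rewrite size_takel ?(ltnW sj) // => i ki oi ij; rewrite take_takel ?(ltnW ij) //.
have [Pi Ci] := Ps i ki oi (ltn_trans ij sj); split=> // ij'.
by apply: Ci; apply: ltn_trans sj.
Qed.

Lemma legal_unravelled P c s : legal P c s -> T' (annotate P c s).
Proof. by exists P, c, s. Qed.

Lemma unravelled_legal P c s : T' (annotate P c s) -> k.+1 < size s -> legal P c s.
Proof.
move=> [P' [c' [s' [/annotate_inj [<- PP cc] l]]]] ks.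
by rewrite PP ?cc // ltnW.
Qed.

Lemma unravelled_tree : is_tree T'.
Proof.
split; first by exists set0, None, [::]; split=> //; split=> //; case: T_tree.
move=> s m [P [c [s' [e l]]]]; exists P, c, (take (size s) s'); split.
  by rewrite -take_annotate -e take_rcons_size.
exact: legal_take.
Qed.

Lemma unravelled_map s : T' s -> T (map fst s).
Proof. by move=> [P [c [s' [-> []]]]]; rewrite map_fst_annotate. Qed.

Lemma unravelled_annotate P c s : T' (annotate P c s) -> T s.
Proof. by move=> /unravelled_map; rewrite map_fst_annotate. Qed.

Lemma legal_small P s : T s -> size s <= k.+2 -> legal P None s.
Proof. by move=> Ts sk; split=> // j kj _ js; lia. Qed.

(** The answer does not show before move [k.+1], so acceptance may be assumed, and acceptance
    imposes nothing yet. *)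
Lemma unravelled_small P c s : T s -> size s <= k.+1 -> T' (annotate P c s).
Proof.
move=> Ts sk; rewrite (@eq_annotate _ P _ None) //; last by lia.
by apply/legal_unravelled/legal_small => //; lia.
Qed.

Lemma unravelled_rcons_inv P c s m' : T' (rcons (annotate P c s) m') ->
  exists m P' c', [/\ rcons (annotate P c s) m' = annotate P' c' (rcons s m),
    legal P' c' (rcons s m), k < size s -> P' = P & k.+1 < size s -> c' = c].
Proof.
move=> [P' [c' [s' [e l]]]].
have es := congr1 (map fst) e; rewrite map_rcons !map_fst_annotate in es.
rewrite -es annotate_rcons in e; have := e => /rcons_inj [/annotate_inj [_ PP cc] _].
exists m'.1, P', c'; rewrite annotate_rcons; split=> //; first by rewrite es.
  by move=> ks; rewrite PP.
by move=> ks; rewrite cc.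
Qed.

Definition bad_index s j := [&& odd j == odd k & ~~ `[< C (take j s) >]].

(** Only proper prefixes count: a position outside [C] is recorded once the mover has moved on from
    it. This matches [legal], which tests [take j s] against the promise from length [j.+1] on. *)
Definition first_bad s :=
  omap (take^~ s) (ohead [seq j <- iota k.+2 (size s - k.+2) | bad_index s j]).

Lemma first_bad_rcons s m : first_bad (rcons s m) =
  if first_bad s is Some v then Some v else
  if [&& k.+1 < size s, odd (size s) == odd k & ~~ `[< C s >]] then Some s else None.
Proof.
rewrite /first_bad size_rcons.
have [ks|sk] := ltnP k.+1 (size s); last first.
  have -> : (size s).+1 - k.+2 = 0 by lia.
  by have -> : size s - k.+2 = 0 by lia.
have -> : (size s).+1 - k.+2 = (size s - k.+2) + 1 by lia.
rewrite iotaD filter_cat.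
have -> : [seq j <- iota k.+2 (size s - k.+2) | bad_index (rcons s m) j] =
          [seq j <- iota k.+2 (size s - k.+2) | bad_index s j].
  apply: eq_in_filter => j; rewrite mem_iota => jb.
  by rewrite /bad_index take_rcons_le //; lia.
have jlt j : j \in [seq j <- iota k.+2 (size s - k.+2) | bad_index s j] -> j <= size s.
  by rewrite mem_filter mem_iota; lia.
case: (seq.filter _ _) jlt => [|j l] /= jlt; last by rewrite take_rcons_le // jlt ?mem_head.
rewrite subnKC // /bad_index take_rcons_size.
by case: ifP => //= _; rewrite take_rcons_size.
Qed.

Lemma first_badP s v : first_bad s = Some v -> exists j,
  [/\ k.+1 < j, j < size s, odd j = odd k, v = take j s & ~ C v].
Proof.
rewrite /first_bad => H.
have : forall j, j \in [seq j <- iota k.+2 (size s - k.+2) | bad_index s j] ->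
    [/\ k.+1 < j, j < size s, odd j = odd k & ~ C (take j s)].
  move=> j; rewrite mem_filter mem_iota => /andP[/andP[/eqP oj /asboolPn Cj] jb].
  by split=> //; lia.
case: (seq.filter _ _) H => //= j l [<-] /(_ j (mem_head _ _))[kj js oj Cj].
by exists j.
Qed.

Lemma first_bad_none s : first_bad s = None -> forall j, k.+1 < j ->
  odd j = odd k -> j < size s -> C (take j s).
Proof.
rewrite /first_bad => H j kj oj js; apply: contrapT => Cj.
have : j \in [seq j <- iota k.+2 (size s - k.+2) | bad_index s j].
  rewrite mem_filter mem_iota /bad_index oj eqxx /=; apply/andP; split; last by lia.
  exact/asboolPn.
by case: (seq.filter _ _) H.
Qed.

Lemma first_bad_small s : size s <= k.+2 -> first_bad s = None.
Proof. by move=> sk; rewrite /first_bad; have -> : size s - k.+2 = 0 by lia. Qed.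

Lemma first_bad_rcons_parity s m : odd (size s) != odd k ->
  first_bad (rcons s m) = first_bad s.
Proof.
by move=> /negbTE os; rewrite first_bad_rcons os andbF; case: first_bad.
Qed.

Lemma first_bad_mkseq x n v m : first_bad (mkseq x n) = Some v -> n <= m ->
  first_bad (mkseq x m) = Some v.
Proof.
move=> nv; elim: m => [|m IH]; first by rewrite leqn0 => /eqP <-.
rewrite leq_eqVlt => /orP[/eqP <- //|/IH mv].
by rewrite mkseqS first_bad_rcons mv.
Qed.

Lemma legal_some_rcons P v s m : legal P (Some v) s -> size v <= size s ->
  T (rcons s m) -> legal P (Some v) (rcons s m).
Proof.
move=> [Ts [Cv ov kv Pv vs]] vs' Tm; split=> //; split=> //.
rewrite take_rcons_le // vs !take_oversize // size_rcons; exact: leqW.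
Qed.

(* Once a challenge [u] has been issued, all moves up to [u] are forced. *)
Lemma strategy_follow b n S P u j : strategy T' b n S -> legal P (Some u) u ->
  size u <= n -> k < j -> k.+1 < j \/ b = odd k ->
  S (annotate P (Some u) (take j u)) ->
  forall i, j <= i -> i <= size u -> S (annotate P (Some u) (take i u)).
Proof.
move=> SS lu un kj jb Sj; elim=> [|i IH]; first by lia.
rewrite leq_eqVlt => /orP[/eqP <- //|ji] iu; have {IH}Si := IH ji (ltnW iu).
have [m im] := take_succ iu.
have si : size (take i u) = i by rewrite size_takel // ltnW.
case: (eqVneq (odd i) b) => ib.
  (* The answer must precede this move, so that the challenge [u] is fixed and legality leaves only
     the next move of [u]. *)
  have ki : k.+1 < i.
    case: jb => [|bk]; first by lia.
    suff : i <> k.+1 by lia.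
    by move=> e; move: ib; rewrite e /= bk; case: (odd k).
  have [||m' Sm'] := strategy_own SS Si; rewrite ?size_annotate ?si //.
    exact: leq_trans un.
  have [m1 [P1 [c1 [e [_ l1] PP cc]]]] := unravelled_rcons_inv (strategy_sub SS Sm').
  rewrite cc ?si // in e l1; rewrite PP ?si ?(ltnW ki) // in e l1.
  have [_ _ _ _] := l1; rewrite size_rcons si => eu.
  suff -> : take i.+1 u = rcons (take i u) m1 by rewrite -e.
  by rewrite -eu take_oversize // size_rcons si.
rewrite im annotate_rcons; apply: (strategy_opp SS) => //.
- by rewrite size_annotate si; apply: leq_trans un.
- by rewrite size_annotate si.
- by rewrite -annotate_rcons -im; apply/legal_unravelled/legal_take.
Qed.

(** * Strategy maps that read positions through a labelling *)

Section generic_lift.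
Variables (b : bool)
  (L : set (seq move) -> seq M -> set (seq M) * option (seq M)).

Local Notation lift S s := (annotate (L S s).1 (L S s).2 s).

(** Length [k.+1] is treated apart for the sake of locality: the responder's label below looks at
    positions of length [k.+2], so at length [k.+1] it would look one level ahead. *)
Definition project (S : set (seq move)) : set (seq M) := [set s |
  forall j, j <= size s -> if j == k.+1
    then exists P, S (annotate P None (take j s)) else S (lift S (take j s))].

Hypothesis L_agree : forall n S S', agree n S S' -> forall s,
  k.+1 < size s -> size s <= n -> L S s = L S' s.
Hypothesis L_own : forall n S s, strategy T' b n S -> project S s ->
  k < size s -> size s < n -> odd (size s) = b -> exists m, S (lift S (rcons s m)).
Hypothesis L_opp : forall n S s m, strategy T' b n S -> project S s ->
  k < size s -> size s < n -> odd (size s) != b -> T (rcons s m) ->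
  S (lift S (rcons s m)).
Hypothesis L_branch : forall S x, (forall n, strategy T' b n S) ->
  branch (project S) x -> exists P c N, forall n, N <= n -> S (annotate P c (mkseq x n)).

Lemma project_self S s : project S s -> size s != k.+1 -> S (lift S s).
Proof. by move=> /(_ _ (leqnn _)) + /negbTE sk; rewrite sk take_size. Qed.

Lemma project_rcons S s m : project S s ->
  (if size s == k then exists P, S (annotate P None (rcons s m))
   else S (lift S (rcons s m))) -> project S (rcons s m).
Proof.
move=> Ss Sm j; rewrite size_rcons leq_eqVlt => /orP[/eqP ->|js].
  by rewrite eqSS take_oversize ?size_rcons.
by rewrite take_rcons_le //; apply: Ss.
Qed.

(** Up to length [k] labels do not show, and beyond it the hypotheses on [L] apply. Along a branch
    the labels are eventually constant, and closure under prefixes extends the limit label to the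
    whole branch. *)
Lemma project_lifts_strategies : lifts_strategies k T T' fst b project.
Proof.
have small P c P' c' s : size s <= k -> annotate P c s = annotate P' c' s.
  by move=> sk; apply: eq_annotate; lia.
split.
- have H n S S' : agree n S S' -> forall s, size s <= n -> project S s -> project S' s.
    move=> SS' s sn Ss j js; have /= := Ss j js.
    have jn : size (take j s) <= n by rewrite size_takel //; apply: leq_trans sn.
    case: eqP => [jk [P SP]|jk].
      by exists P; apply/SS' => //; rewrite size_annotate.
    have [jk'|kj] := leqP j k.
      rewrite (@small _ _ (L S' (take j s)).1 (L S' (take j s)).2); last first.
        by rewrite size_takel.
      by move=> H; apply/SS' => //; rewrite size_annotate.
    rewrite (L_agree SS') //; last by rewrite size_takel //; lia.
    by move=> H; apply/SS' => //; rewrite size_annotate.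
  move=> n S S' SS' s sn; split; first exact: H SS' _ sn.
  by apply: (H n) sn => s' ?; symmetry; apply: SS'.
- move=> n S SS; split.
  + by move=> j; rewrite leqn0 => /eqP -> /=; apply: strategy_nil SS.
  + move=> s /(_ _ (leqnn _)); rewrite take_size.
    by case: eqP => [_ [P]|_] /(strategy_sub SS) /unravelled_annotate.
  + move=> s m Ss j js; have := Ss j; rewrite size_rcons take_rcons_le //.
    by apply; apply: leqW.
  + move=> s Ss sn sb; have [ks|sk] := ltnP k (size s).
      have [m Sm] := L_own SS Ss ks sn sb; exists m; apply: project_rcons => //.
      by case: eqP => // e; lia.
    have Sl := project_self Ss (negbT (ltn_eqF (leq_ltn_trans sk (ltnSn k)))).
    have [||m' Sm'] := strategy_own SS Sl; rewrite ?size_annotate //.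
    have [m [P [c [e _ _ _]]]] := unravelled_rcons_inv (strategy_sub SS Sm').
    exists m; apply: project_rcons => //; case: eqP => [sk'|sk'].
      exists P; rewrite (@eq_annotate _ P _ c) -?e // size_rcons; lia.
    by rewrite (@small _ _ P c) -?e // size_rcons; lia.
  + move=> s m Ss sn sb Tm; have [ks|sk] := ltnP k (size s).
      apply: project_rcons => //.
      case: eqP => e; first by lia.
      exact: (L_opp SS).
    have Sl := project_self Ss (negbT (ltn_eqF (leq_ltn_trans sk (ltnSn k)))).
    (* The move is the opponent's, and so is the promise when [size s = k]. Any promise is legal, so
       [set0] serves. *)
    have Sa : S (annotate set0 None (rcons s m)).
      rewrite annotate_rcons (@small _ _ (L S s).1 (L S s).2) //.
      apply: (strategy_opp SS) => //; rewrite ?size_annotate //.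
      rewrite (@small _ _ set0 None) // -annotate_rcons.
      by apply: unravelled_small; rewrite ?size_rcons.
    apply: project_rcons => //; case: eqP => sk'; first by exists set0.
    by rewrite (@small _ _ set0 None) // size_rcons; lia.
- move=> S SS s sk; split=> [Ss|[s' Ss' s'E] j].
    exists (lift S s); last by rewrite map_fst_annotate.
    by apply: project_self => //; lia.
  have [P [c [s1 [e _]]]] := strategy_sub SS Ss'; subst s' s.
  rewrite map_fst_annotate in sk * => js.
  case: eqP => [jk|_]; first by lia.
  rewrite (@small _ _ P c) -?take_annotate; first exact: (strategy_take _ SS).
  by rewrite size_takel // (leq_trans js sk).
- move=> S SS x Sx; have [P [c [N SN]]] := L_branch SS Sx.
  exists (fun i => (x i, label P c i)) => // n.
  rewrite -(@take_mkseq _ _ n (maxn n N)) ?leq_maxl // -annotate_mkseq.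
  by apply: (strategy_take _ (SS 0)); apply: SN; apply: leq_maxr.
Qed.

End generic_lift.

Lemma project_promise L S s : project L S s -> k < size s ->
  exists P, S (annotate P None (take k.+1 s)).
Proof. by move=> /(_ k.+1) + ks => /(_ ks); rewrite eqxx. Qed.

(** * Strategies of the mover of stage [k] *)

Section mover.
Implicit Types S : set (seq move).

(* A play stays in the accepting branch until it leaves [C] at a position [v], and
   is then reinterpreted as a play in which [v] had been challenged. *)
Definition promise S s := pickd set0 (fun P => S (annotate P None (take k.+1 s))).

Lemma promiseP S s : (exists P, S (annotate P None (take k.+1 s))) ->
  S (annotate (promise S s) None (take k.+1 s)).
Proof. exact: (@pickdP _ set0 (fun P => S (annotate P None (take k.+1 s)))). Qed.

Definition mover_label S s := (promise S s, first_bad s).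

Local Notation L := mover_label.
Local Notation lift S s := (annotate (L S s).1 (L S s).2 s).

Lemma promise_rcons S s m : k < size s -> promise S (rcons s m) = promise S s.
Proof. by move=> ks; rewrite /promise take_rcons_le. Qed.

Lemma mover_agree n S S' : agree n S S' -> forall s,
  k.+1 < size s -> size s <= n -> L S s = L S' s.
Proof.
move=> SS' s ks sn; congr (_, _); apply: eq_pickd => P; apply: SS'.
by rewrite size_annotate size_takel; lia.
Qed.

Lemma mover_own n S s : strategy T' (odd k) n S -> project L S s ->
  k < size s -> size s < n -> odd (size s) = odd k ->
  exists m, S (lift S (rcons s m)).
Proof.
move=> SS Ss ks sn sb.
have ks' : k.+1 < size s.
  by rewrite ltn_neqAle ks andbT; apply/eqP => e; move: sb; rewrite -e /=; case: (odd k).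
have SP : S (annotate (promise S s) None (take k.+1 s)).
  exact: promiseP (project_promise Ss ks).
have Sl : S (lift S s) by apply: project_self Ss _; lia.
have [||m' Sm'] := strategy_own SS Sl; rewrite ?size_annotate //.
have [m [P [c [e l PE cE]]]] := unravelled_rcons_inv (strategy_sub SS Sm').
rewrite PE // cE //= in e l => {P c PE cE}.
case fs : (first_bad s) => [v|].
  exists m; rewrite /L /= promise_rcons // first_bad_rcons fs.
  by move: Sm'; rewrite e /= fs.
have [Cs|nCs] := pselect (C s).
  exists m; rewrite /L /= promise_rcons // first_bad_rcons fs.
  by rewrite (asboolT Cs) !andbF; move: Sm'; rewrite e /= fs.
(* Here [s] is the first position outside [C]. As [S] still moves there after acceptance, [s] is not
   in the promise; hence it could have been challenged, and the play is reread under that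
   challenge. *)
move: l; rewrite fs => -[Tm /(_ (size s) ks' sb)].
rewrite size_rcons take_rcons_size => -[//|nPs _].
have Ts : T s by case: T_tree => _ TP; apply: TP Tm.
have lu : legal (promise S s) (Some s) s by split.
have Sk1 : S (annotate (promise S s) (Some s) (take k.+1 s)).
  by rewrite (@eq_annotate _ (promise S s) _ None) // size_takel // ltnn.
have := strategy_follow SS lu (ltnW sn) (ltnSn k) (or_intror erefl) Sk1
  (ltnW ks') (leqnn _).
rewrite take_size => Ssx.
have [||m1 Sm1] := strategy_own SS Ssx; rewrite ?size_annotate //.
have [m2 [P [c [e2 l2 PE cE]]]] := unravelled_rcons_inv (strategy_sub SS Sm1).
rewrite PE // cE // in e2.
exists m2; rewrite /L /= promise_rcons // first_bad_rcons fs ks' sb eqxx /=.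
by rewrite asboolF //= -e2.
Qed.

(** The opponent never moves at a length that [first_bad] inspects, so the label persists and only
    legality has to be checked. *)
Lemma mover_opp n S s m : strategy T' (odd k) n S -> project L S s ->
  k < size s -> size s < n -> odd (size s) != odd k -> T (rcons s m) ->
  S (lift S (rcons s m)).
Proof.
move=> SS Ss ks sn sb Tm.
rewrite /L /= promise_rcons // first_bad_rcons_parity // annotate_rcons.
have SP : S (annotate (promise S s) None (take k.+1 s)).
  exact: promiseP (project_promise Ss ks).
have Sl : S (lift S s).
  case: (eqVneq (size s) k.+1) => [e|]; last exact: project_self.
  by move: SP; rewrite -e take_size /= first_bad_small // e.
apply: (strategy_opp SS) => //; rewrite ?size_annotate // -annotate_rcons.
apply: legal_unravelled.
case: (eqVneq (size s) k.+1) => [e|sk].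
  by rewrite first_bad_small ?e //; apply: legal_small => //; rewrite size_rcons e.
have ks' : k.+1 < size s by lia.
have := unravelled_legal (strategy_sub SS Sl) ks'.
rewrite /L /=; case fs : (first_bad s) => [v|] l.
  apply: legal_some_rcons => //.
  by have [j [_ js _ -> _]] := first_badP fs; rewrite size_takel // ltnW.
split=> // j kj oj; rewrite size_rcons ltnS leq_eqVlt => /orP[/eqP e|js].
  by move: sb; rewrite -e oj eqxx.
rewrite take_rcons_le ?(ltnW js) //; have [_ /(_ j kj oj js)[nP _]] := l.
by split=> // _; apply: first_bad_none fs _ _ _ _.
Qed.

(** Beyond length [k.+1] the promise is fixed, and [first_bad] changes at most once. *)
Lemma mover_branch S x : (forall n, strategy T' (odd k) n S) ->
  branch (project L S) x ->
  exists P c N, forall n, N <= n -> S (annotate P c (mkseq x n)).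
Proof.
move=> SS Sx.
have lE n : k.+1 < n ->
    S (annotate (promise S (mkseq x k.+1)) (first_bad (mkseq x n)) (mkseq x n)).
  move=> kn; have /= := project_self (Sx n); rewrite size_mkseq => H.
  rewrite (_ : promise _ _ = promise S (mkseq x n)); first by apply: H; lia.
  by rewrite /promise !take_mkseq // ltnW.
exists (promise S (mkseq x k.+1)).
have [[N [v Nv]]|nN] := pselect (exists N v, first_bad (mkseq x N) = Some v).
  exists (Some v), (maxn k.+2 N) => n; rewrite geq_max => /andP[kn Nn].
  by rewrite -(first_bad_mkseq Nv Nn); apply: lE.
exists None, k.+2 => n kn; have := lE n kn.
by case fn : first_bad => [v|] //; case: nN; exists n, v.
Qed.

Lemma mover_lifts : lifts_strategies k T T' fst (odd k) (project L).
Proof.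
exact: (project_lifts_strategies mover_agree mover_own mover_opp mover_branch).
Qed.

End mover.

(** * Strategies of the opponent, who answers the promise *)

Section responder.
Implicit Types S : set (seq move).

(* Promising every position that the strategy would challenge after some promise
   forces it to accept. *)
Definition challengeable S s : set (seq M) := [set u | take k.+1 u = take k.+1 s /\
  exists P, S (annotate P (Some u) (take k.+2 u))].

Definition challenged S u := pickd set0 (fun P => S (annotate P (Some u) (take k.+2 u))).

Lemma challengedP S s u : challengeable S s u ->
  S (annotate (challenged S u) (Some u) (take k.+2 u)).
Proof.
by move=> [_]; apply: (@pickdP _ set0 (fun P => S (annotate P (Some u) (take k.+2 u)))).
Qed.

(** A challengeable [v] is explained by a promise under which [S] challenges it. Any other [v] is
    outside the promise [challengeable S s], and after acceptance the responder would be stuck just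
    after it. *)
Definition responder_label S s :=
  if first_bad s is Some v then
    if pselect (challengeable S s v) then (challenged S v, Some v)
    else (challengeable S s, None)
  else (challengeable S s, None).

Local Notation L := responder_label.
Local Notation lift S s := (annotate (L S s).1 (L S s).2 s).

Lemma challengeable_rcons S s m : k < size s ->
  challengeable S (rcons s m) = challengeable S s.
Proof. by move=> ks; rewrite /challengeable take_rcons_le. Qed.

Lemma challengeable_agree n S S' s : agree n S S' -> k.+2 <= n ->
  challengeable S s = challengeable S' s.
Proof.
move=> SS' kn; apply/seteqP; split=> u [us [P SP]]; split=> //; exists P;
  apply/SS' => //; rewrite size_annotate size_take; case: ltnP; lia.
Qed.

Lemma responder_agree n S S' : agree n S S' -> forall s,
  k.+1 < size s -> size s <= n -> L S s = L S' s.
Proof.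
move=> SS' s ks sn; rewrite /L (challengeable_agree s SS'); last exact: leq_trans sn.
case: first_bad => // v; case: pselect => //= _; congr (_, _).
apply: eq_pickd => P; apply: SS'; rewrite size_annotate size_take; case: ltnP; lia.
Qed.

Lemma challengeable_bad b n S s u : strategy T' b n S -> challengeable S s u ->
  k.+1 < size u -> ~ C u.
Proof.
move=> SS [_ [P /(strategy_sub SS) /unravelled_legal]] + ku.
by rewrite size_takel // => /(_ (ltnSn _))[_ []].
Qed.

Lemma responder_own n S s : strategy T' (~~ odd k) n S -> project L S s ->
  k < size s -> size s < n -> odd (size s) = ~~ odd k ->
  exists m, S (lift S (rcons s m)).
Proof.
move=> SS Ss ks sn sb.
have sb' : odd (size s) != odd k by rewrite sb; case: (odd k).
case: (eqVneq (size s) k.+1) => [e|sk]; last first.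
  have ks' : k.+1 < size s by lia.
  have Sl := project_self Ss sk.
  have [||m' Sm'] := strategy_own SS Sl; rewrite ?size_annotate //.
  have [m [P [c [e l PE cE]]]] := unravelled_rcons_inv (strategy_sub SS Sm').
  rewrite PE // cE // in e; exists m; move: Sm'; rewrite e.
  by rewrite /L first_bad_rcons_parity // challengeable_rcons.
(* The promise is the mover's move, so [S] must admit [challengeable S s] in place of [P]. *)
have SU : S (annotate (challengeable S s) None s).
  have [P] := project_promise Ss ks; rewrite -e take_size => SP.
  have Ts : T s by apply: unravelled_annotate (strategy_sub SS SP).
  have [m sE] : exists m, s = rcons (take k s) m.
    by have [m mE] := take_succ ks; exists m; rewrite -mE -e take_size.
  have Sk : S (annotate (challengeable S s) None (take k s)).
    rewrite (@eq_annotate _ P _ None) ?size_takel ?ltnn // 1?ltnW //.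
    by rewrite -take_annotate; apply: (strategy_take _ SS).
  have TU := unravelled_small (challengeable S s) None Ts (eq_leq e).
  rewrite sE annotate_rcons -sE; apply: (strategy_opp SS) => //.
  - by rewrite size_annotate size_takel 1?ltnW //; lia.
  - by rewrite size_annotate size_takel 1?ltnW //; case: (odd k).
  - by rewrite -annotate_rcons -sE.
have [||m' Sm'] := strategy_own SS SU; rewrite ?size_annotate //.
have [m [P [c [e1 l PE _]]]] := unravelled_rcons_inv (strategy_sub SS Sm').
rewrite PE // in e1 l; exists m.
rewrite /L first_bad_rcons_parity // first_bad_small ?e // challengeable_rcons //=.
(* A challenge [u] would have to avoid the promise, yet being issued by [S] it belongs to
   [challengeable S s]. So the answer is acceptance. *)
case: c e1 l => [u|] e1 l; last by rewrite -e1.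
have [_ [_ _ ku nU]] := l; rewrite size_rcons e take_oversize ?size_rcons ?e // => su.
case: nU; split; last by exists (challengeable S s); rewrite -su -e1.
by rewrite -(@take_takel _ k.+1 k.+2) // -su -e take_rcons_size take_size.
Qed.

Lemma responder_opp n S s m : strategy T' (~~ odd k) n S -> project L S s ->
  k < size s -> size s < n -> odd (size s) != ~~ odd k -> T (rcons s m) ->
  S (lift S (rcons s m)).
Proof.
move=> SS Ss ks sn sb Tm.
have sb' : odd (size s) = odd k by move: sb; case: odd; case: odd.
have ks' : k.+1 < size s.
  by rewrite ltn_neqAle ks andbT; apply/eqP => e; move: sb'; rewrite -e /=; case: (odd k).
have Sl : S (lift S s) by apply: project_self Ss _; lia.
have Ts : T s by apply: unravelled_annotate (strategy_sub SS Sl).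
have ext P c : S (annotate P c s) -> legal P c (rcons s m) -> S (annotate P c (rcons s m)).
  move=> Sa /legal_unravelled; rewrite annotate_rcons.
  by apply: (strategy_opp SS) => //; rewrite size_annotate.
have ll := unravelled_legal (strategy_sub SS Sl) ks'.
rewrite /L first_bad_rcons challengeable_rcons //.
move: Sl ll; rewrite {1 2 3 4}/L; case fs : (first_bad s) => [v|] Sl ll.
  have [j [kj js oj vE nCv]] := first_badP fs.
  move: Sl ll; case: pselect => [Uv|nUv] /= Sl ll.
    apply: ext => //; apply: legal_some_rcons => //.
    by rewrite vE size_takel // ltnW.
  (* After acceptance no play goes two moves past [v], which lies outside [C]; by parity [s] does go
     that far. *)
  have [_ /(_ j kj oj js)[_ /(_ _)]] := ll; rewrite -vE => H.
  case: nCv; apply: H; rewrite ltn_neqAle js andbT.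
  by apply/eqP => e; move: sb'; rewrite -e /= oj; case: (odd k).
rewrite ks' sb' eqxx /=.
have nU j : k.+1 < j -> odd j = odd k -> j < size s ->
    ~ challengeable S s (take j s) /\ (j.+1 < (size s).+1 -> C (take j s)).
  move=> kj oj js; have Cj := first_bad_none fs kj oj js; split=> // Uj.
  by apply: (challengeable_bad SS Uj) => //; rewrite size_takel // ltnW.
have ext' : ~ challengeable S s s ->
    S (annotate (challengeable S s) None (rcons s m)).
  move=> nUs; apply: ext => //; split=> // j kj oj.
  rewrite size_rcons ltnS leq_eqVlt => /orP[/eqP e|js].
    by rewrite e take_rcons_size; split=> //; rewrite ltnn.
  by rewrite take_rcons_le ?(ltnW js) //; apply: nU.
have [Cs|nCs] := pselect (C s).
  rewrite asboolT //=; apply: ext' => Us.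
  exact: (challengeable_bad SS Us).
rewrite asboolF //=; case: pselect => [Us|nUs] /=; last exact: ext'.
(* The play is reread under a promise that [S] answers by challenging [s]; from length [k.+2] on the
   moves up to [s] are forced. *)
have SP : S (annotate (challenged S s) (Some s) (take k.+2 s)).
  exact: challengedP Us.
have lP : legal (challenged S s) (Some s) s.
  have := unravelled_legal (strategy_sub SS SP); rewrite size_takel // => /(_ (ltnSn _)).
  by move=> [_ [? ? ? ? _]].
have := strategy_follow SS lP (ltnW sn) (ltnW (ltnSn k.+1)) (or_introl (ltnSn _))
  SP ks' (leqnn _).
rewrite take_size => Ssx; apply: ext => //; exact: legal_some_rcons.
Qed.

Lemma responder_branch S x : (forall n, strategy T' (~~ odd k) n S) ->
  branch (project L S) x ->
  exists P c N, forall n, N <= n -> S (annotate P c (mkseq x n)).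
Proof.
move=> SS Sx.
have lE n : k.+1 < n -> S (lift S (mkseq x n)).
  by move=> kn; apply: (project_self (Sx n)); rewrite size_mkseq; lia.
have UE n : k.+1 < n -> challengeable S (mkseq x n) = challengeable S (mkseq x k.+1).
  by move=> kn; rewrite /challengeable !take_mkseq // ltnW.
have [[N [v Nv]]|nN] := pselect (exists N v, first_bad (mkseq x N) = Some v); last first.
  exists (challengeable S (mkseq x k.+1)), None, k.+2 => n kn; have := lE n kn.
  by rewrite /L UE //; case fn : first_bad => [v|] //; case: nN; exists n, v.
rewrite /L in lE.
have [Uv|nUv] := pselect (challengeable S (mkseq x k.+1) v).
  exists (challenged S v), (Some v), (maxn k.+2 N) => n; rewrite geq_max => /andP[kn Nn].
  have := lE n kn; rewrite (first_bad_mkseq Nv Nn) UE //.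
  by case: pselect.
exists (challengeable S (mkseq x k.+1)), None, (maxn k.+2 N) => n.
rewrite geq_max => /andP[kn Nn]; have := lE n kn.
by rewrite (first_bad_mkseq Nv Nn) UE //; case: pselect.
Qed.

Lemma responder_lifts : lifts_strategies k T T' fst (~~ odd k) (project L).
Proof.
exact: (project_lifts_strategies responder_agree responder_own responder_opp
  responder_branch).
Qed.

End responder.

Lemma covering_unravelled : covering k T T' fst.
Proof.
split.
- exact: unravelled_tree.
- exact: unravelled_map.
- move=> s s' [P [c [s1 [-> _]]]] [P' [c' [s1' [-> _]]]].
  rewrite size_annotate !map_fst_annotate => sk <-; apply: eq_annotate; lia.
- move=> s Ts sk; exists (annotate set0 None s); last by rewrite map_fst_annotate.
  by apply: unravelled_small => //; lia.
- move=> b; case: (eqVneq b (odd k)) => [->|bk].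
    by eexists; exact: mover_lifts.
  have -> : b = ~~ odd k by move: bk; case: b; case: odd.
  by eexists; exact: responder_lifts.
Qed.

(** The answer at move [k.+1] decides. A challenged play passes through a position outside [C];
    after acceptance an infinite play cannot leave [C], since a dead end would follow. *)
Lemma level_determined_unravelled :
  level_determined T' [set x | branch C (fst \o x)].
Proof.
exists k.+2, [set s' | exists P s, s' = annotate P None s] => x Tx.
have xE n : exists P c, mkseq x n = annotate P c (mkseq (fst \o x) n) /\
    legal P c (mkseq (fst \o x) n).
  have [P [c [s [e l]]]] := Tx n; exists P, c.
  have -> : mkseq (fst \o x) n = s; last by [].
  by rewrite -(map_fst_annotate P c s) -e /mkseq -map_comp.
have [P [c [e0 _]]] := xE k.+2.
have cE n P' c' : k.+1 < n -> mkseq x n = annotate P' c' (mkseq (fst \o x) n) -> c' = c.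
  move=> kn e; have := congr1 (take k.+2) e.
  rewrite take_mkseq // take_annotate take_mkseq // e0 => /annotate_inj[_ _ ->] //.
  by rewrite size_mkseq.
split=> [Cx|[P0 [s0]]].
  case: c e0 cE => [u|] e0 cE; last by exists P, (mkseq (fst \o x) k.+2).
  have [P' [c' [e l]]] := xE (k.+2 + size u).
  have c'E : c' = Some u by apply: cE e; rewrite ltn_addr.
  subst c'; have [_ [nCu _ ku _]] := l.
  rewrite size_mkseq take_mkseq ?leq_addl // take_oversize ?leq_addl // => uE.
  by case: nCu; rewrite -uE; apply: Cx.
rewrite e0 => /annotate_inj[_ _]; rewrite size_mkseq => /(_ (ltnSn _)) cN n; subst c.
(* An index with the parity of [k], beyond both [k.+1] and [n]; legality at length [j.+2] puts the
   prefix of length [j] in [C]. *)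
pose j := k + n.+1.*2.
have [P' [c' [e l]]] := xE j.+2.
have c'N : c' = None by apply: cE e; lia.
subst c'; have [_ /(_ j)] := l; rewrite size_mkseq => H.
have [||//|_ /(_ (ltnSn _))] := H.
- by rewrite /j; lia.
- by rewrite /j oddD odd_double addbF.
rewrite take_mkseq; last by lia.
by move=> /(C_take n); rewrite take_mkseq // /j; lia.
Qed.

End closed_unravelling.

(** * Inverse limits of coverings *)

Section threads.
Variables (M : nat -> Type) (q : forall i, M i.+1 -> M i).

Definition thread := {t : forall i, M i | forall i, q (t i.+1) = t i}.

Definition thread_proj i (t : thread) : M i := sval t i.

Local Notation proj := thread_proj.

Lemma thread_projE i t : q (proj i.+1 t) = proj i t.
Proof. exact: (svalP t). Qed.

Lemma map_thread_projE i s : map (@q i) (map (proj i.+1) s) = map (proj i) s.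
Proof. by rewrite -map_comp; apply: eq_map => t; apply: thread_projE. Qed.

Lemma eq_thread t t' : (forall i, proj i t = proj i t') -> t = t'.
Proof.
case: t t' => [t tE] [t' tE'] /= tt'.
have e : t = t' by apply/functional_extensionality_dep => i; apply: tt'.
by subst t'; congr exist; apply: Prop_irrelevance.
Qed.

Lemma eq_thread_seq s s' : (forall i, map (proj i) s = map (proj i) s') -> s = s'.
Proof.
elim: s s' => [|t s IH] [|t' s'] // ss'; try by have := ss' 0.
congr (_ :: _); first by apply: eq_thread => i; have [] := ss' i.
by apply: IH => i; have [] := ss' i.
Qed.

(* [above a b]: the element [b] of a later stage projects to [a]; the relation
   spares transports along equalities between stages. *)
Inductive above i (a : M i) : forall j, M j -> Prop :=
| above_refl : above a a
| above_succ j (b : M j.+1) : above a (q b) -> above a b.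

Lemma above_inv i (a : M i) j (b : M j) : above a b ->
  existT M i a = existT M j b \/ exists2 a', q a' = a & above a' b.
Proof.
elim=> [|{}j {}b ab [e|[a' a'E a'b]]]; first by left.
  right; suff : (fun p => exists2 a', q a' = projT2 p & above a' b) (existT M i a) by [].
  by rewrite e; exists b => //; apply: above_refl.
by right; exists a' => //; apply: above_succ.
Qed.

Lemma above_eq i (a b : M i) : above a b -> a = b.
Proof.
have H (j : nat) (c : M j) : above a c -> i < j \/ existT M i a = existT M j c.
  elim=> [|{}j {}c _ [ij|e]]; [by right|by left; apply: ltnW|left].
  by have /= -> := congr1 (@projT1 _ _) e.
move=> /H[|e]; first by rewrite ltnn.
exact: (Eqdep_dec.inj_pair2_eq_dec _ PeanoNat.Nat.eq_dec _ _ _ _ e).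
Qed.

(** Project [m] down to stage [0], then climb: follow the images of [m] up to stage [j], and choose
    preimages by [up] from there on. *)
Lemma thread_through (ok : forall i, M i -> Prop) j (m : M j) : ok j m ->
  (forall i (a : M i.+1), ok i.+1 a -> ok i (q a)) ->
  (forall i a, j <= i -> ok i a -> exists2 a', ok i.+1 a' & q a' = a) ->
  exists2 t, forall i, ok i (proj i t) & proj j t = m.
Proof.
move=> okm down up.
pose good i (a : M i) := ok i a /\ (above a m \/ (j <= i /\ above m a)).
have above_ok i (a : M i) : above a m -> ok i a.
  by move: okm => + am; elim: am => // i' b _ IH /down.
have [a0 good0] : exists a0, good 0 a0.
  suff [a0 ok0 am] : exists2 a0, ok 0 a0 & above a0 m by exists a0; split=> //; left.
  clear good up above_ok; elim: j m okm => [|i IH] m okm.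
    by exists m => //; apply: above_refl.
  have [a0 ok0 am] := IH (q m) (down _ _ okm).
  by exists a0 => //; apply: above_succ.
have step i (a : M i) : good i a -> exists2 a', good i.+1 a' & q a' = a.
  move=> [oka [/above_inv[e|[a' a'E a'm]]|[ji ma]]].
  - have ji : j <= i by have /= -> := congr1 (@projT1 _ _) e.
    have [a' oka' a'E] := up i a ji oka; exists a' => //; split=> //; right.
    split; first exact: leqW.
    apply: above_succ; rewrite a'E.
    suff : (fun p => above m (projT2 p)) (existT M i a) by [].
    by rewrite e; apply: above_refl.
  - by exists a' => //; split; [apply: above_ok a'm|left].
  - have [a' oka' a'E] := up i a ji oka; exists a' => //; split=> //; right.
    by split; [exact: leqW|apply: above_succ; rewrite a'E].
pose t := fix t i : {a : M i | good i a} := if i is i'.+1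
  then let s := cid2 (step i' (sval (t i')) (svalP (t i'))) in
       exist _ (s2val s) (s2valP s)
  else exist _ a0 good0.
have tE i : q (sval (t i.+1)) = sval (t i) by rewrite /=; case: cid2.
exists (exist _ (fun i => sval (t i)) tE) => [i|]; first by case: (svalP (t i)).
rewrite /proj /=; have [_ [/above_eq //|[_ /above_eq -> //]]] := svalP (t j).
Qed.

End threads.

Section inverse_limit.
Variables (M : nat -> Type) (T : forall i, set (seq (M i))).
Variables (q : forall i, M i.+1 -> M i) (k : nat).
Arguments T : clear implicits.
Hypothesis T0_tree : is_tree (T 0).
Hypothesis T_covering : forall i, covering (k + i) (T i) (T i.+1) (@q i).

Local Notation proj i := (@thread_proj M q i).

Definition limit_tree : set (seq (thread q)) :=
  [set s | forall i, T i (map (proj i) s)].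

Let T_tree i : is_tree (T i).
Proof. by case: i => // i; apply: covering_tree (T_covering i). Qed.

Lemma limit_tree_is_tree : is_tree limit_tree.
Proof.
split=> [i|s m Tm i]; first by case: (T_tree i).
by have := Tm i; rewrite map_rcons; case: (T_tree i) => _; apply.
Qed.

(** From stage [i] on the coverings are bijective at the lengths concerned, so a move at stage [i]
    lifts through all later stages. *)
Lemma limit_tree_rcons s i m : limit_tree s -> size s < k + i ->
  T i (rcons (map (proj i) s) m) ->
  exists2 t, limit_tree (rcons s t) & proj i t = m.
Proof.
move=> Ts si Tm.
have [||t Tt tm] := @thread_through M q
  (fun j a => T j (rcons (map (proj j) s) a)) i m Tm.
- move=> j a /(covering_map (T_covering j)).
  by rewrite map_rcons map_thread_projE.
- move=> j a ij Ta; have [|s' Ts' s'E] := covering_surj (T_covering j) Ta.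
    by rewrite size_rcons size_map (leq_trans si) // leq_add2l.
  case/lastP: s' Ts' s'E => [|s' a'] Ts'; first by move=> /(congr1 size); rewrite size_rcons.
  rewrite map_rcons => /rcons_inj[s'E a'E]; exists a' => //.
  rewrite (covering_inj (T_covering j) (Ts j.+1) (s' := s')) //.
  + by case: (T_tree j.+1) => _; apply; apply: Ts'.
  + by rewrite size_map ltnW // (leq_trans si) // leq_add2l.
  + by rewrite map_thread_projE.
by exists t => // j; rewrite map_rcons; apply: Tt.
Qed.

Lemma limit_tree_inj s s' i : limit_tree s -> limit_tree s' -> size s <= k + i ->
  map (proj i) s = map (proj i) s' -> s = s'.
Proof.
move=> Ts Ts' si e; apply: eq_thread_seq => j.
have [ij|ji] := leqP i j.
  elim: j ij => [|j IH]; first by rewrite leqn0 => /eqP <-.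
  rewrite leq_eqVlt => /orP[/eqP <- //|ij].
  apply: (covering_inj (T_covering j)) => //; last by rewrite !map_thread_projE IH.
  by rewrite size_map (leq_trans si) // leq_add2l.
move: e; rewrite -(subnK (ltnW ji)); elim: (i - j) => // d IH.
rewrite addSn => e; apply: IH.
by rewrite -(map_thread_projE (d + j) s) e map_thread_projE.
Qed.

Section limit_strategy.
Variable b : bool.
Variable phi : forall i, set (seq (M i.+1)) -> set (seq (M i)).
Hypothesis phiP : forall i, lifts_strategies (k + i) (T i) (T i.+1) (@q i) b (@phi i).

(** Project [S] to stage [i + d], then bring it down to stage [i] by [d] strategy maps. *)
Fixpoint approx (S : set (seq (thread q))) d i : set (seq (M i)) :=
  if d is d'.+1 then phi (@approx S d' i.+1) else map (proj i) @` S.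
Arguments approx : clear implicits.

(** Depth [size s] suffices: approximations of depth [d] are stable on positions of length at most
    [k + i + d]. *)
Definition limit_strategy S i : set (seq (M i)) := [set s | approx S (size s) i s].
Arguments limit_strategy : clear implicits.

Local Notation sigma := limit_strategy.

Lemma approx_agree n S S' d i : agree n S S' -> agree n (approx S d i) (approx S' d i).
Proof.
move=> SS'; elim: d i => [|d IH] i /=; last exact: (lifts_agree (phiP i)).
have H U U' : agree n U U' -> forall s, size s <= n ->
    (map (proj i) @` U) s -> (map (proj i) @` U') s.
  move=> UU' s sn [s' Us' s'E]; exists s' => //; apply/UU' => //.
  by rewrite -(size_map (proj i)) s'E.
move=> s sn; split; first exact: H.
by apply: H sn => s' ?; symmetry; apply: SS'.
Qed.

Lemma image_strategy n S i : strategy limit_tree b n S -> n <= k + i ->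
  strategy (T i) b n (map (proj i) @` S).
Proof.
move=> SS ni; split.
- by exists [::] => //; apply: strategy_nil SS.
- by move=> _ [s /(strategy_sub SS) Ts <-]; apply: Ts.
- move=> s m [s' Ss' e]; case/lastP: s' Ss' e => [|s' m'] Ss'.
    by move=> /(congr1 size); rewrite size_rcons.
  by rewrite map_rcons => /rcons_inj[<- _]; exists s' => //; apply: strategy_rcons SS _ _ Ss'.
- move=> _ [s Ss <-]; rewrite size_map => sn sb; have [m Sm] := strategy_own SS Ss sn sb.
  by exists (proj i m), (rcons s m) => //; rewrite map_rcons.
- move=> _ m [s Ss <-]; rewrite size_map => sn sb.
  move=> /(limit_tree_rcons (strategy_sub SS Ss) (leq_trans sn ni))[t Tt tm].
  by exists (rcons s t); [exact: (strategy_opp SS)|rewrite map_rcons tm].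
Qed.

Lemma approx_strategy n S d i : strategy limit_tree b n S -> n <= k + i + d ->
  strategy (T i) b n (approx S d i).
Proof.
move=> SS; elim: d i => [|d IH] i /= ni.
  by apply: image_strategy; rewrite ?addn0 in ni *.
by apply: (lifts_strategy (phiP i)); apply: IH; rewrite addnS addSnnS.
Qed.

(** For [d = 0] this is [lifts_low]: on short positions the strategy map is the projection. Locality
    of the strategy maps propagates it downwards. *)
Lemma approx_stable S d i : strategy limit_tree b 0 S ->
  agree (k + i + d) (approx S d i) (approx S d.+1 i).
Proof.
move=> SS; elim: d i => [|d IH] i; last first.
  have -> : k + i + d.+1 = k + i.+1 + d by lia.
  by apply: (lifts_agree (phiP i)); apply: IH.
rewrite addn0 => s si /=.
have SS1 : strategy (T i.+1) b 0 (map (proj i.+1) @` S) by apply: image_strategy.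
split=> [[s' Ss' s'E]|/(lifts_low (phiP i) SS1 si)[_ [s' Ss' <-]] <-].
  apply/(lifts_low (phiP i) SS1 si).
  by exists (map (proj i.+1) s'); [exists s'|rewrite map_thread_projE].
by exists s' => //; rewrite map_thread_projE.
Qed.

Lemma approx_limit S n d i : strategy limit_tree b 0 S -> n <= k + i + d ->
  agree n (approx S d i) (sigma S i).
Proof.
move=> SS nd s sn.
have H e d' : size s <= k + i + d' -> (approx S d' i s <-> approx S (e + d') i s).
  elim: e => [|e IH] sd' //; apply: iff_trans (IH sd') _.
  by rewrite addSn; apply: (approx_stable SS); lia.
have h1 := H (size s) d (leq_trans sn nd).
have h2 : approx S (size s) i s <-> approx S (d + size s) i s by apply: H; lia.
by rewrite /sigma /= h1 h2 addnC.
Qed.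

(** The limit strategies form a coherent system under the maps [phi], and on short positions they
    are the projections of [S]. *)
Lemma limit_strategy_phi S i : strategy limit_tree b 0 S ->
  agree (k + i) (sigma S i) (map (proj i) @` S) /\
  forall s, phi (sigma S i.+1) s <-> sigma S i s.
Proof.
move=> SS; split=> [s si|s].
  by symmetry; apply: (@approx_limit S (k + i) 0 i SS _ s si); rewrite addn0.
have e1 : agree (size s) (sigma S i.+1) (approx S (size s) i.+1).
  by move=> s' ss'; symmetry; apply: (approx_limit SS _ ss'); lia.
apply: iff_trans ((lifts_agree (phiP i) e1) s (leqnn _)) _.
by apply: (@approx_limit S (size s) (size s).+1 i SS) => //; lia.
Qed.

Lemma limit_strategy_strategy n S i : strategy limit_tree b n S ->
  strategy (T i) b n (sigma S i).
Proof.
move=> SS; have S0 := strategy_le (leq0n n) SS.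
pose N (s : seq (M i)) := (size s + n).+1.
have aS s : strategy (T i) b n (approx S (N s) i).
  by apply: approx_strategy => //; rewrite /N; lia.
have aE s s' : size s' <= N s -> (approx S (N s) i s' <-> sigma S i s').
  by move=> ss'; apply: (@approx_limit S (N s) (N s) i S0) => //; lia.
have sN s : size s <= N s by rewrite /N; lia.
have sN1 s m : size (rcons s m) <= N s by rewrite size_rcons /N; lia.
split.
- exact/aE/(strategy_nil (aS [::])).
- by move=> s /(aE s s (sN s)) /(strategy_sub (aS s)).
- by move=> s m /(aE s _ (sN1 _ _)) /(strategy_rcons (aS s)) /aE; apply.
- move=> s /(aE s s (sN s)) Ss sn sb; have [m Sm] := strategy_own (aS s) Ss sn sb.
  by exists m; apply/(aE s).
- move=> s m /(aE s s (sN s)) Ss sn sb Tm; apply/(aE s) => //.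
  exact: (strategy_opp (aS s)).
Qed.

Lemma limit_lifts : lifts_strategies k (T 0) limit_tree (proj 0) b (sigma^~ 0).
Proof.
split.
- by move=> n S S' SS' s sn; apply: approx_agree SS' _ sn.
- by move=> n S SS; apply: limit_strategy_strategy.
- move=> S SS s sk; have [+ _] := limit_strategy_phi 0 SS.
  by move=> /(_ s); rewrite addn0; apply.
- move=> S SS x Sx; have S0 := SS 0.
  (* A play is lifted through one stage at a time; by dependent choice the lifts form a play of
     threads. *)
  have step i (y : {y | branch (sigma S i) y}) :
      exists2 y', branch (sigma S i.+1) y' & @q i \o y' = sval y.
    apply: (lifts_branch (phiP i)) => [n|n]; first exact: limit_strategy_strategy.
    by have [_ H] := limit_strategy_phi i S0; apply/H/(svalP y).
  pose y := fix y i : {y | branch (sigma S i) y} := if i is i'.+1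
    then let s := cid2 (step i' (y i')) in exist _ (s2val s) (s2valP s)
    else exist _ x Sx.
  have yE n i : q (sval (y i.+1) n) = sval (y i) n.
    by rewrite /=; case: cid2 => /= y' _ /(congr1 (@^~ n)).
  exists (fun n => exist _ (fun i => sval (y i) n) (yE n)) => //= n.
  have xE i : map (proj i) (mkseq (fun n => exist _ (fun i => sval (y i) n) (yE n)) n) =
      mkseq (sval (y i)) n.
    by rewrite /mkseq -map_comp.
  (* At stage [n] positions of length [n] are short: the lifted position has the same projection as
     a position of [S], hence equals it. *)
  have [+ _] := limit_strategy_phi n S0.
  move=> /(_ (mkseq (sval (y n)) n)); rewrite size_mkseq leq_addl => /(_ isT)[+ _].
  move=> /(_ (svalP (y n) n))[s Ss sE].
  suff -> : mkseq (fun n => exist _ (fun i => sval (y i) n) (yE n)) n = s by [].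
  apply: (@limit_tree_inj _ _ n); rewrite ?size_mkseq ?leq_addl //.
  + move=> i; rewrite xE; have := svalP (y i) n.
    by move=> /(strategy_sub (limit_strategy_strategy i S0)).
  + exact: strategy_sub S0 _ Ss.
  + by rewrite xE sE.
Qed.

End limit_strategy.

Lemma covering_limit : covering k (T 0) limit_tree (proj 0).
Proof.
split.
- exact: limit_tree_is_tree.
- by move=> s Ts; apply: Ts.
- by move=> s s' Ts Ts' sk; apply: limit_tree_inj => //; rewrite addn0.
- elim/last_ind => [|s m IH] Ts sk.
    by exists [::] => //; case: limit_tree_is_tree.
  rewrite size_rcons in sk.
  have [|s' Ts' s'E] := IH _ (ltnW sk); first by case: T0_tree => _; apply; apply: Ts.
  have [||t Tt tm] := @limit_tree_rcons s' 0 m Ts'.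
  + by rewrite addn0 -(size_map (proj 0)) s'E.
  + by rewrite s'E.
  by exists (rcons s' t) => //; rewrite map_rcons s'E tm.
- move=> b; pose phi i := projT1 (cid (covering_lifts (T_covering i) b)).
  exists ((limit_strategy phi)^~ 0); apply: limit_lifts => i.
  exact: (projT2 (cid (covering_lifts (T_covering i) b))).
Qed.

End inverse_limit.

(** * Borel determinacy *)

Lemma map_mkseq (A B : Type) (f : A -> B) (x : nat -> A) n :
  map f (mkseq x n) = mkseq (f \o x) n.
Proof. by rewrite /mkseq -map_comp. Qed.

(** * Unravelable sets are closed under complements and countable unions *)

Section unravelable.
Variables (M : Type) (T : set (seq M)).

(** The quantification over all trees above [T] and all [k] allows a set to be unravelled after
    others have been. *)
Definition unravelable (A : set (nat -> M)) := forall (M' : Type)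
    (T' : set (seq M')) (p : M' -> M) k,
  is_tree T' -> (forall s, T' s -> T (map p s)) ->
  exists (M'' : Type) (T'' : set (seq M'')) (q : M'' -> M'),
    covering k T' T'' q /\ level_determined T'' [set x | A (p \o q \o x)].

Lemma unravelable_level_determined A : level_determined T A -> unravelable A.
Proof.
move=> [n [D AD]] M' T' p k T't T'T; exists M', T', id.
split; first exact: covering_id.
exists n, [set s | D (map p s)] => x Tx; rewrite /= map_mkseq; apply: AD => m.
by rewrite -map_mkseq; apply: T'T.
Qed.

Lemma eq_unravelable A B : (forall x, branch T x -> (A x <-> B x)) ->
  unravelable A -> unravelable B.
Proof.
move=> AB Au M' T' p k T't T'T; have [M'' [T'' [q [cov [n [D AD]]]]]] := Au M' T' p k T't T'T.
exists M'', T'', q; split=> //; exists n, D => x Tx.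
rewrite -AD //=; symmetry; apply: AB => m.
by rewrite -map_mkseq map_comp; apply/T'T/(covering_map cov).
Qed.

Lemma unravelableC A : unravelable A -> unravelable (~` A).
Proof.
move=> Au M' T' p k T't T'T; have [M'' [T'' [q [cov [n [D AD]]]]]] := Au M' T' p k T't T'T.
exists M'', T'', q; split=> //; exists n, (~` D) => x Tx.
by split; apply: contra_not => /(AD x Tx).
Qed.

Record stage := Stage {
  stage_move :> Type;
  stage_tree : set (seq stage_move);
  stage_map : stage_move -> M;
  stage_is_tree : is_tree stage_tree;
  stage_mapP : forall s, stage_tree s -> T (map stage_map s) }.
Arguments stage_tree : clear implicits.
Arguments stage_map : clear implicits.

Record next_stage (A : set (nat -> M)) k (st : stage) := NextStage {
  next :> stage;
  next_map : next -> st;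
  next_covering : covering k (stage_tree st) (stage_tree next) next_map;
  next_mapE : stage_map next = stage_map st \o next_map;
  next_determined : level_determined (stage_tree next)
    [set x | A (stage_map next \o x)] }.

Lemma next_stage_exists A k st : unravelable A -> inhabited (next_stage A k st).
Proof.
case: st => M' T' p T't T'T Au; have [M'' [T'' [q [cov det]]]] := Au M' T' p k T't T'T.
have T''T s : T'' s -> T (map (p \o q) s).
  by move=> Ts; rewrite map_comp; apply/T'T/(covering_map cov).
by exists; exists (Stage (covering_tree cov) T''T) q.
Qed.

(** Unravel the sets one after another, the [i]-th with parameter [k + i]. In the limit each is
    decided at some level, so their union is open; the complement is closed and can be unravelled in
    turn. *)
Lemma unravelable_bigcup (A : nat -> set (nat -> M)) :
  (forall i, unravelable (A i)) -> unravelable (\bigcup_i A i).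
Proof.
move=> Au M' T' p k T't T'T.
have step i st : next_stage (A i) (k + i) st.
  exact: inhabited_witness (next_stage_exists (k + i) st (Au i)).
pose st := fix st i := if i is i'.+1 then next (step i' (st i')) else Stage T't T'T.
pose q i : st i.+1 -> st i := @next_map _ _ _ (step i (st i)).
pose T_ i : set (seq (st i)) := stage_tree (st i).
pose p_ i : st i -> M := stage_map (st i).
have cov i : covering (k + i) (T_ i) (T_ i.+1) (@q i) by apply: next_covering.
have lcov := @covering_limit (fun i => stage_move (st i)) T_ q k T't cov.
set L := @limit_tree _ _ _ in lcov.
pose pr i := @thread_proj (fun i => stage_move (st i)) q i.
have pE i : p_ i \o pr i = p \o pr 0.
  elim: i => [//|i <-]; apply/funext => t /=.
  rewrite /pr -(thread_projE i t) /p_ /= next_mapE //.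
have [i|f fP] := @choice nat (nat * set (seq (thread q)))
    (fun i nD => forall x, branch L x ->
      (A i (p \o pr 0 \o x) <-> nD.2 (mkseq x nD.1))).
  have [n [D AD]] := next_determined (step i (st i)).
  exists (n, [set s | D (map (pr i.+1) s)]) => x Lx /=.
  rewrite map_mkseq -AD => [|m]; last first.
    by rewrite -map_mkseq; exact: (Lx m i.+1).
  by rewrite -(pE i.+1).
(* The positions at which no [A i] has yet been decided positively; their branches make up the
   complement of the union. *)
pose C := [set s | forall i, (f i).1 <= size s -> ~ (f i).2 (take (f i).1 s)].
have C_rcons s m : C (rcons s m) -> C s.
  move=> Cs i si; have := Cs i; rewrite size_rcons take_rcons_le //.
  by apply; apply: leqW.
have Ltree := covering_tree lcov.
exists _, (unravelled k L C), (pr 0 \o fst); split.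
  by apply: covering_comp lcov _; apply: covering_unravelled.
have [n [D CD]] := level_determined_unravelled k L C_rcons.
exists n, (~` D) => x Tx; rewrite /= -CD //.
have Lx : branch L (fst \o x).
  by move=> m; rewrite -map_mkseq; apply: unravelled_map.
split=> [[i _ Ai] Cx|nC].
  have := Cx (f i).1 i; rewrite size_mkseq leqnn take_mkseq //; apply=> //.
  exact/fP.
apply: contrapT => nA; apply: nC => m i; rewrite size_mkseq => im.
by rewrite take_mkseq // => /(fP i _ Lx) Ai; apply: nA; exists i.
Qed.

Lemma unravelable_determined A : is_tree T -> unravelable A ->
  exists b S, (forall n, strategy T b n S) /\
    forall x, branch S x -> if b then A x else ~ A x.
Proof.
move=> Tt Au; have [|M' [T' [q [cov det]]]] := Au M T id 0 Tt.
  by move=> s; rewrite map_id.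
have T't := covering_tree cov.
suff [b [S [SS SA]]] : exists b S, (forall n, strategy T' b n S) /\
    forall x, branch S x -> if b then A (q \o x) else ~ A (q \o x).
  have [phi [_ ps _ pb]] := covering_lifts cov b; exists b, (phi S); split.
    by move=> n; apply: ps.
  by move=> x /(pb _ SS)[x' Sx' <-]; apply: SA.
have [/(wins_strategy T't)|/(wins_strategy T't)] := level_determined_wins det.
  by move=> [S SS]; exists true, S.
by move=> [S SS]; exists false, S.
Qed.

End unravelable.

(** * The Lipschitz game *)

Lemma unravelableU M (T : set (seq M)) A B :
  unravelable T A -> unravelable T B -> unravelable T (A `|` B).
Proof.
move=> Au Bu; apply: eq_unravelable
  (unravelable_bigcup (A := fun i => if i is 0 then A else B) _).
  move=> x _; split=> [[[|i] _]|[Ax|Bx]]; [by left|by right|by exists 0|by exists 1].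
by case.
Qed.

Section refining_equivalences.
Variables (X : Type) (E : nat -> X -> X -> Prop) (x0 : X).
Hypothesis E_refl : forall i x, E i x x.
Hypothesis E_sym : forall i x y, E i x y -> E i y x.
Hypothesis E_trans : forall i x y z, E i x y -> E i y z -> E i x z.
Hypothesis E_succ : forall i x y, E i.+1 x y -> E i x y.
Hypothesis E_sep : forall x y, (forall i, E i x y) -> x = y.

Definition coherent (z : nat -> X) := forall i, E i (z i) (z i.+1).

Hypothesis E_complete : forall z, coherent z -> exists l, forall i, E i l (z i).

Definition Eopen (U : set X) := forall x, U x -> exists i, forall y, E i x y -> U y.

(** The sigma-algebra generated by [Eopen], stated as its induction principle. *)
Definition EBorel (A : set X) := forall G : set (set X), Eopen `<=` G ->
  (forall B, G B -> G (~` B)) ->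
  (forall F : nat -> set X, (forall i, G (F i)) -> G (\bigcup_i F i)) -> G A.

Lemma E_leq i j x y : i <= j -> E j x y -> E i x y.
Proof.
by move=> ij; rewrite -(subnK ij); elim: (j - i) => // d IH /E_succ /IH.
Qed.

Definition limit (z : nat -> X) := pickd x0 (fun l => forall i, E i l (z i)).

Lemma limitP z : coherent z -> forall i, E i (limit z) (z i).
Proof. by move=> /E_complete; apply: (@pickdP _ x0 (fun l => forall i, E i l (z i))). Qed.

Lemma limit_unique z x : (forall i, E i x (z i)) -> limit z = x.
Proof.
move=> xz; apply: E_sep => i; apply: E_trans (E_sym (xz i)).
by apply: (@pickdP _ x0 (fun l => forall i, E i l (z i))); exists x.
Qed.

(** Entries [i] and [i.+2] belong to the same player: the even entries approximate the first
    player's point, the odd ones the second player's. *)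
Definition lipschitz_tree : set (seq X) :=
  [set s | forall i, i.+2 < size s -> E i./2 (nth x0 s i) (nth x0 s i.+2)].

Local Notation T := lipschitz_tree.

Lemma lipschitz_tree_is_tree : is_tree T.
Proof.
split=> // s m Ts i si; have si1 : i < size s by lia.
by have := Ts i; rewrite size_rcons !nth_rcons si si1; apply; apply: ltnW.
Qed.

Lemma lipschitz_tree_rcons s m : T s ->
  (forall i, size s = i.+2 -> E i./2 (nth x0 s i) m) -> T (rcons s m).
Proof.
move=> Ts sm i; rewrite size_rcons ltnS leq_eqVlt => /orP[/eqP e|si].
  by rewrite !nth_rcons -e ltnn eqxx ltnW //; apply: sm.
have si1 : i < size s by lia.
by rewrite !nth_rcons si si1; apply: Ts.
Qed.

Definition coord (b : bool) (x : nat -> X) i := x (i.*2 + b).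

Lemma branch_coherent b x : branch T x -> coherent (coord b x).
Proof.
move=> Tx i; have := Tx (i.*2 + b).+3 (i.*2 + b).
have n1 : i.*2 + b < (i.*2 + b).+3 by lia.
rewrite size_mkseq !nth_mkseq // => /(_ (leqnn _)).
by rewrite addnC half_bit_double /coord doubleS !addSn addnC.
Qed.

Lemma unravelable_coord b A : EBorel A -> unravelable T [set x | A (limit (coord b x))].
Proof.
move=> /(_ [set A | unravelable T [set x | A (limit (coord b x))]]); apply.
- move=> U Uo /=.
  (* The limit lies in the open set [U] exactly when at some stage the whole class of the current
     approximation does. *)
  apply: (@eq_unravelable _ _ (\bigcup_i [set x | forall y, E i (coord b x i) y -> U y])).
    move=> x /(branch_coherent b)/limitP xl; split=> [[i _ xU]|Ul].
      by apply: xU; apply: E_sym.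
    have [i iU] := Uo _ Ul; exists i => // y xy; apply: iU.
    exact: E_trans xy.
  apply: unravelable_bigcup => i; apply: unravelable_level_determined.
  exists (i.*2 + b).+1, [set s | forall y, E i (nth x0 s (i.*2 + b)) y -> U y] => x _.
  have e : nth x0 (mkseq x (i.*2 + b).+1) (i.*2 + b) = coord b x i by rewrite nth_mkseq.
  by split=> H y; have := H y; rewrite e.
- by move=> B; apply: unravelableC.
- move=> F Fu.
  apply: (@eq_unravelable _ _ (\bigcup_i [set x | F i (limit (coord b x))])).
    by move=> x _; split=> -[i _ Fx]; exists i.
  exact: unravelable_bigcup.
Qed.

Definition lipschitz_payoff (A B : set X) : set (nat -> X) :=
  [set x | A (limit (coord false x)) <-> B (limit (coord true x))].

Lemma unravelable_payoff A B : EBorel A -> EBorel B -> unravelable T (lipschitz_payoff A B).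
Proof.
move=> /(unravelable_coord false) Au /(unravelable_coord true) Bu.
set A' := [set x | _] in Au; set B' := [set x | _] in Bu.
apply: (@eq_unravelable _ _ (~` (A' `|` B') `|` ~` (~` A' `|` ~` B'))); last first.
  apply: unravelableU; apply: unravelableC; apply: unravelableU => //;
    exact: unravelableC.
move=> x _; rewrite /A' /B' /lipschitz_payoff /=.
have [Ax|nAx] := pselect (A (limit (coord false x)));
  have [Bx|nBx] := pselect (B (limit (coord true x))); tauto.
Qed.

Section response.
Variables (b : bool) (S : set (seq X)).
Hypothesis S_strategy : forall n, strategy T b n S.

Fixpoint response (z : nat -> X) n : seq X := if n is n'.+1 then
    rcons (response z n') (if odd n' == b
      then pickd x0 (fun m => S (rcons (response z n') m)) else z n'./2)
  else [::].

Definition response_move z n := if odd n == b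
  then pickd x0 (fun m => S (rcons (response z n) m)) else z n./2.

Lemma responseE z n : response z n = mkseq (response_move z) n.
Proof. by elim: n => // n IH; rewrite mkseqS -IH. Qed.

Lemma response_strategy z : coherent z -> branch S (response_move z).
Proof.
move=> cz n; rewrite -responseE; elim: n => [|n IH].
  exact: strategy_nil (S_strategy 0).
have sr : size (response z n) = n by rewrite responseE size_mkseq.
have SS := S_strategy n.+1.
rewrite /=; case: eqP => nb.
  apply: (@pickdP _ x0 (fun m => S (rcons (response z n) m))).
  by apply: (strategy_own SS) => //; rewrite sr.
apply: (strategy_opp SS) => //; rewrite ?sr //; first exact/eqP.
apply: lipschitz_tree_rcons; first exact: strategy_sub SS _ IH.
rewrite sr => i ni; subst n; rewrite responseE nth_mkseq; last by lia.
rewrite /response_move; case: eqP => [ib|_]; last exact: cz.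
by case: nb; rewrite /= negbK.
Qed.

Lemma eq_response z z' n :
  (forall i, i < n -> odd i != b -> z i./2 = z' i./2) -> response z n = response z' n.
Proof.
elim: n => // n IH zz' /=; rewrite IH; last by move=> i ni; apply: zz'; apply: ltnW.
by case: eqP => // /eqP nb; rewrite zz'.
Qed.

(* Playing representatives makes the moves depend only on the [E i]-classes. *)
Definition representative x i := pickd x0 (E i x).

Lemma representativeP x i : E i x (representative x i).
Proof. by apply: (@pickdP _ x0 (E i x)); exists x. Qed.

Lemma eq_representative x y i : E i x y -> representative x i = representative y i.
Proof.
move=> xy; apply: eq_pickd => z; split; last exact: E_trans.
by apply: E_trans; apply: E_sym.
Qed.

(** A move at time [i.*2 + b] depends only on the opponent's moves at earlier times [j.*2 + ~~ b].
    That means [j <= i] for the second player and [j < i] for the first, who thus gains a level. *)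
Lemma strategy_function : exists f,
  (forall i x y, (forall j, j.*2 + ~~ b < i.*2 + b -> E j x y) -> E i (f x) (f y)) /\
  forall x, exists2 w, branch S w & limit (coord (~~ b) w) = x /\ limit (coord b w) = f x.
Proof.
have crep x : coherent (representative x).
  move=> i; apply: E_trans (E_sym (representativeP x i)) _.
  exact: E_succ (representativeP x i.+1).
exists (fun x => limit (coord b (response_move (representative x)))).
have sT : S `<=` T := strategy_sub (S_strategy 0).
have fP x i : E i (limit (coord b (response_move (representative x))))
    (response_move (representative x) (i.*2 + b)).
  by apply: limitP; apply: branch_coherent => n; apply/sT/response_strategy.
split=> [i x y xy|x].
  apply: E_trans (fP x i) _; apply: E_trans (E_sym (fP y i)).
  rewrite /response_move oddD odd_double addFb oddb eqxx.
  rewrite (@eq_response _ (representative y)) //.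
  move=> j ji jb; apply: eq_representative; apply: xy.
  rewrite -[X in X < _](odd_double_half j) in ji *.
  by move: jb ji; case: (odd j); case: (b) => //=; lia.
exists (response_move (representative x)); first exact: response_strategy.
split=> //; apply: limit_unique => i.
rewrite /coord /response_move oddD odd_double addFb oddb.
have -> : (~~ b == b) = false by case: (b).
by rewrite addnC half_bit_double; apply: representativeP.
Qed.

End response.

Lemma lipschitz_dichotomy A B : EBorel A -> EBorel B ->
  (exists f, (forall i x y, E i x y -> E i (f x) (f y)) /\ A = f @^-1` B) \/
  (exists g, [/\ forall x y, E 0 (g x) (g y),
                 forall i x y, E i x y -> E i.+1 (g x) (g y) & ~` B = g @^-1` A]).
Proof.
move=> Ab Bb.
have [b [S [SS SW]]] :=
  unravelable_determined lipschitz_tree_is_tree (unravelable_payoff Ab Bb).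
have [f [fE fW]] := strategy_function SS.
case: b SS SW fE fW => SS SW fE fW; [left|right]; exists f; split.
- move=> i x y xy; apply: fE => j ji; apply: (E_leq _ xy).
  by move: ji; rewrite -!muln2 /=; lia.
- apply/seteqP; split=> x /=; have [w /SW + [<- <-]] := fW x;
    by rewrite /lipschitz_payoff /=; tauto.
- by move=> x y; apply: fE => j; rewrite -!muln2 /=; lia.
- move=> i x y xy; apply: fE => j ji; apply: (E_leq _ xy).
  by move: ji; rewrite -!muln2 /=; lia.
- apply/seteqP; split=> x /=; have [w /SW + [<- <-]] := fW x;
    rewrite /lipschitz_payoff /= => nW.
    by move=> nB; apply: contrapT => nA; apply: nW; tauto.
  by move=> Af Bx; apply: nW; tauto.
Qed.

End refining_equivalences.

(** * The Martin-Monk argument *)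

Section category.
Implicit Types (s t u : seq bool) (z : nat -> bool) (G S : set (nat -> bool)).

Definition cylinder s : set (nat -> bool) := [set z | mkseq z (size s) = s].

(** Each [D i] codes the open set of sequences having a prefix in it; the first clause is
    density. *)
Definition comeager G := exists D : nat -> set (seq bool),
  (forall i s, exists t, D i (s ++ t)) /\
  forall z, (forall i, exists n, D i (mkseq z n)) -> G z.

Lemma comeagerT G : (forall z, G z) -> comeager G.
Proof. by move=> GT; exists (fun=> setT); split=> // i s; exists [::]. Qed.

Lemma comeagerS G G' : G `<=` G' -> comeager G -> comeager G'.
Proof. by move=> GG' [D [Dd DG]]; exists D; split=> // z /DG /GG'. Qed.

Lemma comeager_forall (I : countType) (G : I -> set (nat -> bool)) :
  (forall i, comeager (G i)) -> comeager [set z | forall i, G i z].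
Proof.
move=> /choice[D DP].
exists (fun k => if unpickle k is Some (i, j) then D i j else setT); split.
  move=> k s; case: (unpickle k) => [[i j]|]; last by exists [::].
  by have [+ _] := DP i; apply.
move=> z Dz i; have [_] := DP i; apply=> j; have := Dz (pickle (i, j)).
by rewrite pickleK.
Qed.

Lemma comeager_imply (P : Prop) G : (P -> comeager G) -> comeager [set z | P -> G z].
Proof.
have [p|np] := pselect P => [/(_ p)|_]; first by apply: comeagerS => z Gz _.
by apply: comeagerT => z p; case: (np p).
Qed.

Definition comeager_in s S := comeager [set z | cylinder s z -> S z].

(** A local form of the property of Baire: below every cylinder, [S] or its complement is comeager
    in some cylinder. *)
Definition Baire_property S := forall s, exists t,
  comeager_in (s ++ t) S \/ comeager_in (s ++ t) (~` S).

Lemma Baire_propertyC S : Baire_property S -> Baire_property (~` S).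
Proof.
move=> BS s; have [t [c|c]] := BS s; exists t; [right|by left].
by rewrite setCK.
Qed.

(** If no [S i] is comeager in a cylinder below [s], each is meager in densely many of them, hence
    in [cylinder s], and so is the union. *)
Lemma Baire_property_bigcup (S : nat -> set (nat -> bool)) :
  (forall i, Baire_property (S i)) -> Baire_property (\bigcup_i S i).
Proof.
move=> BS s.
have [[i [t c]]|nc] := pselect (exists i t, comeager_in (s ++ t) (S i)).
  by exists t; left; apply: comeagerS c => z zS /zS Sz; exists i.
exists [::]; right; rewrite cats0.
suff c i : comeager_in s (~` S i).
  by apply: comeagerS (comeager_forall c) => z zS zs [i _]; apply: zS.
have dense t : exists u, comeager_in (s ++ t ++ u) (~` S i).
  have [u [c|c]] := BS i (s ++ t); exists u; rewrite catA //.
  by case: nc; exists i, (t ++ u); rewrite catA.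
have c1 : comeager [set z | forall t, comeager_in (s ++ t) (~` S i) ->
    cylinder (s ++ t) z -> ~ S i z].
  by apply: comeager_forall => t; apply: comeager_imply.
have c2 : comeager [set z | cylinder s z ->
    exists2 t, comeager_in (s ++ t) (~` S i) & cylinder (s ++ t) z].
  exists (fun=> [set r | size s <= size r /\ (take (size s) r = s ->
    exists2 t, r = s ++ t & comeager_in r (~` S i))]); split.
    (* Appending [s] only serves to reach length [size s]. *)
    move=> _ r; have [e|ne] := pselect (take (size s) (r ++ s) = s); last first.
      by exists s; split=> //; rewrite size_cat leq_addl.
    have rE := cat_take_drop (size s) (r ++ s); rewrite e in rE.
    have [u cu] := dense (drop (size s) (r ++ s)).
    exists (s ++ u); rewrite catA -rE -catA; split=> [|_].
      by rewrite size_cat leq_addr.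
    by exists (drop (size s) (r ++ s) ++ u).
  move=> z /(_ 0)[n [+ zn]] zs; rewrite size_mkseq => sn.
  have [|t tE ct] := zn; first by rewrite take_mkseq.
  by exists t; rewrite -tE // /cylinder /= size_mkseq.
pose G (b : bool) := if b then [set z | forall t, comeager_in (s ++ t) (~` S i) ->
    cylinder (s ++ t) z -> ~ S i z] else [set z | cylinder s z ->
    exists2 t, comeager_in (s ++ t) (~` S i) & cylinder (s ++ t) z].
have : comeager [set z | forall b, G b z] by apply: comeager_forall; case.
by apply: comeagerS => z Gz /(Gz false)[t ct zt]; apply: (Gz true) ct zt.
Qed.

Definition prepend s (v : nat -> bool) n :=
  if n < size s then nth false s n else v (n - size s).

Lemma mkseq_prepend s v n : mkseq (prepend s v) (size s + n) = s ++ mkseq v n.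
Proof.
rewrite /mkseq iotaD map_cat add0n; congr (_ ++ _).
  rewrite -[RHS](mkseq_nth false) /mkseq; apply/eq_in_map => i.
  by rewrite mem_iota /prepend => /andP[_ ->].
rewrite -[X in iota X n]addn0 iotaDl -map_comp; apply: eq_map => i /=.
by rewrite /prepend ltnNge leq_addr /= addKn.
Qed.

(** The tail is built in steps, the [i]-th meeting [D i] both after [s] and after [s']. *)
Lemma comeager_common_tail G s s' : comeager G ->
  exists v, G (prepend s v) /\ G (prepend s' v).
Proof.
move=> [D [Dd DG]].
have [i|ext extP] := @choice (nat * seq bool) (seq bool) (fun iu w =>
    (exists n, D iu.1 (s ++ take n (iu.2 ++ w))) /\
    (exists n, D iu.1 (s' ++ take n (iu.2 ++ w))) /\ 0 < size w).
  case: i => i u /=; have [a Da] := Dd i (s ++ u); have [a' Da'] := Dd i (s' ++ u ++ a).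
  (* [a] serves [s], then [a'] serves [s']; the final [false] makes the word nonempty, so that the
     [u i] grow without bound. *)
  exists (a ++ rcons a' false); split; last split.
  - by exists (size (u ++ a)); rewrite catA take_size_cat // catA.
  - exists (size (u ++ a ++ a')); rewrite -cats1 !catA take_size_cat //.
    by move: Da'; rewrite !catA.
  - by rewrite size_cat size_rcons addnS.
pose u := fix u i := if i is i'.+1 then u i' ++ ext (i', u i') else [::] : seq bool.
have u_size i : i <= size (u i).
  elim: i => //= i IH; rewrite size_cat -addn1 leq_add //.
  by have [_ [_ ]] := extP (i, u i).
have u_mono i j : i <= j -> exists w, u j = u i ++ w.
  move=> ij; rewrite -(subnK ij); elim: (j - i) => [|d [w uE]]; first by exists [::]; rewrite cats0.
  by rewrite addSn /=; exists (w ++ ext (d + i, u (d + i))); rewrite {1}uE catA.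
pose v n := nth false (u n.+1) n.
have vE i n : n <= size (u i) -> mkseq v n = take n (u i).
  move=> ni; apply: (@eq_from_nth _ false).
    by rewrite size_mkseq size_takel.
  rewrite size_mkseq => m mn; rewrite nth_mkseq // nth_take // /v.
  have [w wE] := u_mono _ _ (leq_maxl m.+1 i).
  have [w' w'E] := u_mono _ _ (leq_maxr m.+1 i).
  have <- : nth false (u (maxn m.+1 i)) m = nth false (u m.+1) m.
    by rewrite wE nth_cat u_size.
  by rewrite w'E nth_cat (leq_trans mn ni).
have met r : (forall i, exists n, D i (r ++ take n (u i.+1))) -> G (prepend r v).
  move=> Dr; apply: DG => i; have [n Dn] := Dr i.
  exists (size r + size (take n (u i.+1))); rewrite mkseq_prepend.
  rewrite (vE i.+1); last by rewrite size_take_min geq_minr.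
  by rewrite size_take_min take_min take_size.
by exists v; split; apply: met => i; have [? [? _]] := extP (i, u i).
Qed.

End category.

Section Martin_Monk.
Variables (X : Type) (E : nat -> X -> X -> Prop) (x0 : X).
Hypothesis E_sym : forall i x y, E i x y -> E i y x.
Hypothesis E_trans : forall i x y z, E i x y -> E i y z -> E i x z.
Hypothesis E_sep : forall x y, (forall i, E i x y) -> x = y.
Hypothesis E_complete : forall z, coherent E z -> exists l, forall i, E i l (z i).

Variables (A : nat -> set X) (g : nat -> bool -> X -> X).
Hypothesis A_Borel : EBorel E (A 0).
Hypothesis g_const : forall n c x y, E 0 (g n c x) (g n c y).
Hypothesis g_contract : forall n c i x y, E i x y -> E i.+1 (g n c x) (g n c y).
Hypothesis g_reduce : forall n c y,
  A n (g n c y) <-> if c then A n.+1 y else ~ A n.+1 y.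

Implicit Types z : nat -> bool.

Fixpoint iterate z n N := if N is N'.+1 then g n (z n) (iterate z n.+1 N') else x0.

Definition iterate_limit z n := limit E x0 (fun i => iterate z n i.+1).

Local Notation x_ := iterate_limit.

Lemma iterate_limitP z n i : E i (x_ z n) (iterate z n i.+1).
Proof.
apply: (limitP x0 E_complete) => {}i; elim: i n => [|i IH] n; first exact: g_const.
by apply: g_contract; apply: IH.
Qed.

(** Both sides have the same [E i]-class for every [i], because the maps are contractions. *)
Lemma iterate_limitE z n : x_ z n = g n (z n) (x_ z n.+1).
Proof.
apply: E_sep => i; apply: E_trans (iterate_limitP z n i) _; apply: E_sym.
case: i => [|i]; first exact: g_const.
by apply: g_contract; apply: iterate_limitP.
Qed.

Lemma eq_iterate z z' n N : (forall m, n <= m -> m < n + N -> z m = z' m) ->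
  iterate z n N = iterate z' n N.
Proof.
elim: N n => //= N IH n zz'; rewrite zz' ?IH // => [m nm mN|]; last by lia.
by apply: zz'; lia.
Qed.

(** Past [n] the bits agree, so the points [x_ z n.+1] and [x_ z' n.+1] coincide. The bit [n] makes
    the memberships differ, and the equal bits below [n] carry the difference down to [0]. *)
Lemma iterate_limit_flip z z' n : (forall m, m != n -> z m = z' m) -> z n != z' n ->
  A 0 (x_ z 0) <-> ~ A 0 (x_ z' 0).
Proof.
move=> zz' zn.
suff H d : d <= n -> (A (n - d) (x_ z (n - d)) <-> ~ A (n - d) (x_ z' (n - d))).
  by have := H n (leqnn _); rewrite subnn.
elim: d => [|d IH] dn.
  have e : x_ z n.+1 = x_ z' n.+1.
    congr limit; apply/funext => i; apply: eq_iterate => m nm _; apply: zz'; lia.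
  rewrite subn0 !(iterate_limitE _ n) !g_reduce -e; move: zn.
  have [?|?] := pselect (A n.+1 (x_ z n.+1));
    by case: (z n); case: (z' n) => //= _; tauto.
have {}IH := IH (ltnW dn); move: IH; have -> : n - d = (n - d.+1).+1 by lia.
set m := n - d.+1 => IH.
rewrite !(iterate_limitE _ m) !g_reduce zz'; last by rewrite /m; lia.
by case: (z' m); rewrite IH.
Qed.

(** Continuity of [z |-> x_ z 0] handles open sets, and the closure properties do the rest. *)
Lemma iterate_limit_Baire B : EBorel E B -> Baire_property [set z | B (x_ z 0)].
Proof.
move=> /(_ [set B | Baire_property [set z | B (x_ z 0)]]); apply.
- move=> U Uo s.
  have [[t tU]|nU] := pselect (exists t, forall z, cylinder (s ++ t) z -> U (x_ z 0)).
    by exists t; left; apply: comeagerT.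
  exists [::]; right; rewrite cats0; apply: comeagerT => z zs Uz.
  have [i iU] := Uo _ Uz; apply: nU.
  (* The first [i.+1] bits determine the [E i]-class; [size s] more keep the cylinder below [s]. *)
  exists (drop (size s) (mkseq z (size s + i.+1))) => z'.
  have -> : s ++ drop (size s) (mkseq z (size s + i.+1)) = mkseq z (size s + i.+1).
    by rewrite -{1}zs -(@take_mkseq _ _ (size s) (size s + i.+1)) ?leq_addr // cat_take_drop.
  rewrite /cylinder /= size_mkseq => zz'; apply: iU.
  apply: E_trans (iterate_limitP z 0 i) _; apply: E_sym.
  rewrite (@eq_iterate z z'); first exact: iterate_limitP.
  move=> m _ mi; have := congr1 (fun r => nth false r m) zz'.
  by rewrite !nth_mkseq //; lia.
- by move=> B0; apply: Baire_propertyC.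
- move=> F FB s; have [t c] := Baire_property_bigcup FB s; exists t.
  by case: c => c; [left|right]; apply: comeagerS c => z H /H; rewrite /bigcup /=.
Qed.

(** A set comeager in [cylinder t] contains two points with a common tail after [rcons t false] and
    [rcons t true]. They differ in one bit, which contradicts the flip. *)
Lemma Martin_Monk : False.
Proof.
have flip S : (forall z z' n, (forall m, m != n -> z m = z' m) -> z n != z' n ->
    S z -> ~ S z') -> forall t, ~ comeager_in t S.
  move=> Sf t /(@comeager_common_tail _ (rcons t false) (rcons t true))[v [H H']].
  have pre c : cylinder t (prepend (rcons t c) v).
    have := mkseq_prepend (rcons t c) v 0; rewrite addn0 cats0 => e.
    rewrite /cylinder /= -(@take_mkseq _ _ _ (size (rcons t c))).
      by rewrite e take_rcons_size.
    by rewrite size_rcons.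
  apply: (Sf (prepend (rcons t false) v) (prepend (rcons t true) v) (size t)).
  - by move=> m mt; rewrite /prepend !size_rcons !nth_rcons (negbTE mt).
  - by rewrite /prepend !size_rcons !leqnn !nth_rcons !ltnn !eqxx.
  - exact: H (pre _).
  - exact: H' (pre _).
have [t [|]] := iterate_limit_Baire A_Borel [::]; apply: flip => z z' n zz' zn.
  by move=> /(iterate_limit_flip zz' zn).
by move=> nA nA'; apply: nA; apply/(iterate_limit_flip zz' zn).
Qed.

End Martin_Monk.

(** * Compact ultrametric spaces *)

Local Open Scope ring_scope.

(** Otherwise the complements of finite unions of [e]-balls generate a proper filter, and the ball
    around a cluster point gives a contradiction. *)
Lemma compact_finite_net (R : realType) (X : metricType R) (e : R) :
  compact [set: X] -> 0 < e -> exists l : seq X, forall x, exists2 c, c \in l & mdist c x < e.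
Proof.
move=> Xc e0; apply: contrapT => nl.
pose F : set_system X := [set B | exists l : seq X,
  forall x, (forall c, c \in l -> ~ mdist c x < e) -> B x].
have FF : ProperFilter F.
  split.
    move=> [l lF]; apply: nl; exists l => x; apply: contrapT => nx.
    by apply: (lF x) => c cl cx; apply: nx; exists c.
  split.
  - by exists [::].
  - move=> P Q [l lP] [l' lQ]; exists (l ++ l') => x xl; split.
      by apply: lP => c cl; apply: xl; rewrite mem_cat cl.
    by apply: lQ => c cl; apply: xl; rewrite mem_cat cl orbT.
  - by move=> P Q PQ [l lP]; exists l => x /lP /PQ.
have [|p [_ pF]] := Xc F FF; first by exists [::].
have [|y [ny]] := pF [set y | ~ mdist p y < e] _ _ (nbhsx_ballx p e e0).
  by exists [:: p] => x; apply; rewrite mem_head.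
by rewrite ballEmdist.
Qed.

Section compact_ultrametric.
Variables (R : realType) (X : metricType R).
Hypothesis X_ultra : ultrametric X.
Hypothesis X_complete : complete_metric X.
Hypothesis X_compact : compact [set: X].

Lemma mdist_ultra (x y z : X) e : mdist x y <= e -> mdist y z <= e -> mdist x z <= e.
Proof.
move=> xy yz; apply: le_trans (X_ultra x y z) _.
by rewrite ge_max xy.
Qed.

Lemma mdist_isosceles (x y z : X) : mdist x y < mdist y z -> mdist x z = mdist y z.
Proof.
move=> xyz; apply/eqP; rewrite eq_le; apply/andP; split.
  exact: mdist_ultra (ltW xyz) (lexx _).
have := X_ultra y x z; rewrite le_max => /orP[|//].
by rewrite (metric_sym y x) leNgt xyz.
Qed.

Definition distance : set R := [set v | exists x y : X, v = mdist x y].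

(** Moving two points at distance at least [e] to centres of an [e]-net does not change their
    distance, by the isosceles property. *)
Lemma finite_distances (e : R) : 0 < e ->
  exists L : seq R, forall v, distance v -> e <= v -> v \in L.
Proof.
move=> e0; have [l lP] := compact_finite_net X_compact e0.
exists [seq mdist c c' | c <- l, c' <- l] => _ [x [y ->]] exy.
have [c cl cx] := lP x; have [c' c'l c'y] := lP y.
have e1 := mdist_isosceles (lt_le_trans cx exy).
have e2 : mdist c' c = mdist y c.
  by apply: mdist_isosceles; rewrite (metric_sym y) e1; apply: lt_le_trans exy.
by apply/allpairsP; exists (c, c'); rewrite /= (metric_sym c) e2 (metric_sym y) e1.
Qed.

Lemma distance_bound : exists2 b : R, 0 < b & forall v, distance v -> v < b.
Proof.
have [L LP] := finite_distances ltr01.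
have [b bP] : exists b, forall v, v \in L -> v < b.
  elim: L {LP} => [|v L [b bP]]; first by exists 0.
  exists (Num.max b (v + 1)) => w; rewrite inE lt_max => /orP[/eqP ->|/bP ->] //.
  by rewrite ltrDl ltr01 orbT.
exists (Num.max b 1) => [|v dv]; first by rewrite lt_max ltr01 orbT.
rewrite lt_max; have [v1|v1] := leP 1 v; last by rewrite orbT.
by rewrite bP // LP.
Qed.

Definition next_distance (r v : R) :=
  [/\ distance v, 0 < v, v < r & forall w, distance w -> w < r -> w <= v].

Lemma next_distance_exists r v : distance v -> 0 < v -> v < r ->
  exists w, next_distance r w.
Proof.
move=> dv v0 vr; have [L LP] := finite_distances v0.
have [w [dw vw wr wL]] : exists w, [/\ distance w, v <= w, w < r &
    forall u, u \in L -> distance u -> u < r -> u <= w].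
  elim: L {LP} => [|u L [w [dw vw wr wL]]]; first by exists v.
  have [[du ur uw]|nu] := pselect ([/\ distance u, u < r & w < u]).
    exists u; split=> // [|t]; first by apply: le_trans (ltW uw).
    by rewrite inE => /orP[/eqP -> //|tL dt tr]; apply: le_trans (ltW uw); apply: wL.
  exists w; split=> // t; rewrite inE => /orP[/eqP -> du ur|]; last exact: wL.
  by rewrite leNgt; apply/negP => wu; apply: nu.
exists w; split=> //; first exact: lt_le_trans vw.
move=> u du ur; have [vu|uv] := leP v u; first by apply: wL => //; apply: LP.
exact: le_trans (ltW uv) vw.
Qed.

(** In use [b] is a strict bound on all distances, so level [0] relates all points. If the positive
    distances run out, the default [0] takes over and the relation becomes equality. *)
Fixpoint scale (b : R) i : R := if i is i'.+1
  then pickd 0 (next_distance (scale b i')) else b.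

Section scale.
Variable b : R.
Hypothesis b_gt0 : 0 < b.
Hypothesis b_bound : forall v, distance v -> v < b.

Local Notation r := (scale b).

Lemma scaleSP i : next_distance (r i) (r i.+1) \/
  r i.+1 = 0 /\ forall v, ~ next_distance (r i) v.
Proof.
rewrite /=; have [[v vP]|nv] := pselect (exists v, next_distance (r i) v).
  by left; apply: pickdP; exists v.
right; split=> [|v vP]; last by apply: nv; exists v.
by rewrite /pickd; case: pselect.
Qed.

Lemma scale_ge0 i : 0 <= r i.
Proof.
case: i => [|i]; first exact: ltW.
by have [[_ /ltW]|[-> _]] := scaleSP i.
Qed.

Lemma scale_leS i : r i.+1 <= r i.
Proof. by have [[_ _ /ltW]|[-> _]] := scaleSP i; rewrite ?scale_ge0. Qed.

Lemma scale_leq i j : (i <= j)%N -> r j <= r i.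
Proof.
move=> ij; rewrite -(subnK ij); elim: (j - i)%N => // d; apply: le_trans.
exact: scale_leS.
Qed.

(** Otherwise the scale would strictly decrease forever through distances at least [e], of which
    there are finitely many. *)
Lemma scale_small e : 0 < e -> exists i, r i < e.
Proof.
move=> e0; apply: contrapT => nr.
have er i : e <= r i by rewrite leNgt; apply/negP => ?; apply: nr; exists i.
have nx i : next_distance (r i) (r i.+1).
  by have [//|[ri _]] := scaleSP i; have := er i.+1; rewrite ri leNgt e0.
have [L LP] := finite_distances e0.
have rlt i j : (i < j)%N -> r j < r i.
  elim: j => // j IH; rewrite ltnS leq_eqVlt => /orP[/eqP ->|/IH]; have [_ _ jr _] := nx j => //.
  exact: lt_trans.
have ur : uniq [seq r i.+1 | i <- iota 0 (size L).+1].
  rewrite map_inj_uniq ?iota_uniq // => i j rij; apply/eqP.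
  by case: ltngtP => // /(rlt _.+1 _.+1); rewrite rij ltxx.
have := uniq_leq_size ur; rewrite size_map size_iota => /(_ L).
suff H : {subset [seq r i.+1 | i <- iota 0 (size L).+1] <= L} by move=> /(_ H); rewrite ltnn.
by move=> _ /mapP[i _ ->]; apply: LP => //; have [] := nx i.
Qed.

Lemma scale_surj v : distance v -> 0 < v -> exists i, r i = v.
Proof.
move=> dv v0; have [n] := scale_small v0.
elim: n => [|n IH] rn; first by have := b_bound dv; rewrite ltNge (ltW rn).
have [/IH //|vn] := ltP (r n) v.
have [e|ne] := eqVneq (r n) v; first by exists n.
have vn' : v < r n by rewrite lt_neqAle eq_sym ne.
have [[_ _ _ /(_ v dv vn')]|[_ nx]] := scaleSP n; first by rewrite leNgt rn.
by have [w /nx] := next_distance_exists dv v0 vn'.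
Qed.

Definition scale_rel i (x y : X) := mdist x y <= r i.

Local Notation E := scale_rel.

Lemma scale_rel_complete z : coherent E z -> exists l, forall i, E i l (z i).
Proof.
move=> cz; have zE i j : (i <= j)%N -> E i (z i) (z j).
  move=> ij; rewrite -(subnK ij); elim: (j - i)%N => [|d IH].
    by rewrite /E mdistxx scale_ge0.
  rewrite addSn; apply: mdist_ultra IH _.
  exact: le_trans (cz _) (scale_leq (leq_addl _ _)).
have [|l zl] := @X_complete z.
  apply: cauchy_exP => e e0; have [i ie] := scale_small e0; exists (z i).
  exists i => // j /= ij; rewrite ballEmdist /=.
  exact: le_lt_trans (zE _ _ ij) ie.
exists l => i; rewrite /E; apply/ler_addgt0Pl => e e0.
have /cvg_ballP /(_ e e0)[n _ nl] := zl.
have := nl (maxn n i) (leq_maxl _ _); rewrite ballEmdist /= => lz.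
apply: mdist_ultra (_ : mdist _ (z (maxn n i)) <= _) _.
  by rewrite ltW // (lt_le_trans lz) // lerDl scale_ge0.
rewrite metric_sym (le_trans (zE _ _ (leq_maxr _ _))) // lerDr ltW //.
Qed.

Lemma Borel_EBorel (A : set X) : Borel A -> EBorel E A.
Proof.
move=> + G Go GC GU; apply; split=> [|U Uo]; last first.
  apply: Go => x Ux; have /nbhs_ballP[e e0 eU] : nbhs x U by apply: open_nbhs_nbhs.
  have [i ie] := scale_small e0; exists i => y xy; apply: eU.
  by rewrite ballEmdist /=; apply: le_lt_trans ie.
split=> //; first by apply: Go => x.
by move=> B GB; rewrite setTD; apply: GC.
Qed.

Lemma scale_rel_nonexpansive f : (forall i x y, E i x y -> E i (f x) (f y)) ->
  nonexpansive_maps f.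
Proof.
move=> fE x y; have [->|xy] := eqVneq x y; first by rewrite !mdistxx.
have dxy : distance (mdist x y) by exists x, y.
have [|i ri] := scale_surj dxy; first by rewrite mdist_gt0.
by rewrite -ri; apply: fE; rewrite /E ri.
Qed.

Lemma scale_relxx i x : E i x x. Proof. by rewrite /E mdistxx scale_ge0. Qed.

Lemma scale_rel_sym i x y : E i x y -> E i y x.
Proof. by rewrite /E metric_sym. Qed.

Lemma scale_rel_trans i x y z : E i x y -> E i y z -> E i x z.
Proof. exact: mdist_ultra. Qed.

Lemma scale_relS i x y : E i.+1 x y -> E i x y.
Proof. by move=> xy; apply: le_trans xy (scale_leS i). Qed.

Lemma scale_rel_sep x y : (forall i, E i x y) -> x = y.
Proof.
move=> xy; apply/eqP; rewrite -[_ == _]negbK -mdist_gt0; apply/negP.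
by move=> /scale_small[i]; rewrite ltNge; case/negP; exact: xy.
Qed.

Lemma nonexpansive_dichotomy (x0 : X) (A B : set X) : Borel A -> Borel B ->
  reducible (@nonexpansive_maps R X) A B \/
  (exists g, [/\ forall x y, E 0 (g x) (g y),
    forall i x y, E i x y -> E i.+1 (g x) (g y) & ~` B = g @^-1` A]).
Proof.
move=> /Borel_EBorel Ab /Borel_EBorel Bb.
have [[f [fE fA]]|] := lipschitz_dichotomy x0 scale_relxx scale_rel_sym
  scale_rel_trans scale_relS scale_rel_sep scale_rel_complete Ab Bb; last by right.
by left; exists f => //; apply: scale_rel_nonexpansive.
Qed.

End scale.

(** One argument serves both classes: the dichotomy concerns nonexpansive maps, and a failure of
    reducibility by [F] excludes these as well. *)
Lemma very_good_nonempty (F : set (X -> X)) (x0 : X) :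
  @nonexpansive_maps R X `<=` F -> (forall f g, F f -> F g -> F (f \o g)) ->
  very_good_on_Borel F.
Proof.
move=> LF Fcomp; have [b b0 bP] := distance_bound.
have dich := nonexpansive_dichotomy b0 bP x0.
have FS A B : reducible (@nonexpansive_maps R X) A B -> reducible F A B.
  by move=> [f /LF Ff ->]; exists f.
split=> [A B Ab Bb|[A [Ab Ad]]].
  have [/FS|[g [_ gE gA]]] := dich A B Ab Bb; [by left|right; apply: FS].
  exists g => //; apply: (scale_rel_nonexpansive bP) => i x y /gE.
  exact: scale_relS.
have BorelC (B : set X) : Borel B -> Borel (~` B).
  by move=> Bb G GP; have [[_ GC _] _] := GP; rewrite -setTD; apply: GC; exact: Bb.
(* The contraction reduces the complement of [B n c] to [A n], so the bit [true] preserves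
   membership and [false] reverses it. *)
pose B n (c : bool) := if c then ~` A n.+1 else A n.+1.
have [[n c]|g gP] := @choice (nat * bool) (X -> X) (fun nc g =>
    [/\ forall x y, scale_rel b 0 (g x) (g y),
      forall i x y, scale_rel b i x y -> scale_rel b i.+1 (g x) (g y) &
      ~` B nc.1 nc.2 = g @^-1` A nc.1]).
  have Bb : Borel (B n c) by case: c; [apply: BorelC|]; apply: Ab.
  have [/FS|//] := dich (A n) (B n c) (Ab n) Bb.
  have [[f Ff fA] nr] := Ad n; case: c Bb => _ // [h Fh hA]; case: nr.
  (* Passing through [h] twice cancels the two complements, so this reduces [A n] to [A n.+1]. *)
  exists (h \o f \o h); first exact: (Fcomp _ _ (Fcomp _ _ Fh Ff) Fh).
  have hE x : A n x = (~ A n.+1 (h x)) by rewrite {1}hA.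
  have fE x : A n.+1 x = A n (f x) by rewrite {1}fA.
  by apply/funext => x; rewrite (hE x) (fE (h x)) (hE (f (h x))) notK.
apply: (@Martin_Monk X (scale_rel b) x0 _ _ _ _ A (fun n c => g (n, c))).
- exact: scale_rel_sym.
- exact: scale_rel_trans.
- exact: scale_rel_sep.
- exact: scale_rel_complete.
- exact: Borel_EBorel.
- by move=> n c; have [] := gP (n, c).
- by move=> n c; have [] := gP (n, c).
- move=> n c y; have [_ _ /(congr1 (@^~ y)) /= e] := gP (n, c).
  by rewrite -e /B; case: (c) => //; split=> [/contrapT|a /(_ a)].
Qed.

End compact_ultrametric.

(** Treated apart because the games need a base point. *)
Lemma very_good_empty (X : topologicalType) (F : set (X -> X)) :
  (X -> False) -> F id -> very_good_on_Borel F.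
Proof.
move=> X0 Fid; have eX (A B : set X) : reducible F A B.
  by exists id => //; apply/seteqP; split=> x; case: (X0 x).
by split=> [A B _ _|[A [_ /(_ 0%N)[_]]]]; [left|].
Qed.

Theorem theorem5p2 (R : realType) (X : metricType R)
    (X_Polish : ultrametric_Polish X) (X_compact : compact [set: X]) :
  very_good_on_Borel (@nonexpansive_maps R X) /\
  very_good_on_Borel (@Lipschitz_maps R X).
Proof.
have [X_ultra _ X_complete] := X_Polish.
have LLip : @nonexpansive_maps R X `<=` @Lipschitz_maps R X.
  by move=> f fL; exists 1 => // x y; rewrite mul1r.
have Lid : @nonexpansive_maps R X id by [].
have [[x0]|nX] := pselect (inhabited X); last first.
  have X0 : X -> False by move=> x; apply: nX; exists.
  by split; apply: very_good_empty => //; apply: LLip.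
split; apply: (very_good_nonempty X_ultra X_complete X_compact x0) => //.
- by move=> f g fL gL x y; apply: le_trans (fL _ _) (gL _ _).
- move=> f g [K K0 fK] [K' K'0 gK']; exists (K * K'); first exact: mulr_ge0.
  by move=> x y; apply: le_trans (fK _ _) _; rewrite -mulrA ler_wpM2l.
Qed.
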